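(* Let $X$ be a locally compact Hausdorff space and let $n\ge 1$. There is a bijection between isomorphism classes of twisted $n$-sheeted coverings of $X$ and isomorphism classes of principal $\mathbb{T}^n\rtimes S_n$-bundles over $X$. Under this bijection, the twist $\mathcal{L}$ of a twisted $n$-sheeted covering $(Z,s,\mathcal{L})$ is trivial if and only if the corresponding principal $\mathbb{T}^n\rtimes S_n$-bundle reduces to an $S_n$-bundle.
   Context: $\mathbb{T}$ is the unit circle in $\mathbb{C}$ and $S_n$ is the permutation group of $\{1,\dots,n\}$. The semidirect product $\mathbb{T}^n\rtimes S_n$ has multiplication $(\lambda,\sigma_1)(\mu,\sigma_2)=(\lambda(\sigma_1\cdot\mu),\sigma_1\sigma_2)$, where $S_n$ acts on $\mathbb{T}^n$ by permuting coordinates, $(\sigma\cdot\mu)_k=\mu_{\sigma^{-1}(k)}$. All principal bundles are assumed locally trivial. Two principal bundles over $X$ are isomorphic if there is an equivariant homeomorphism of total spaces covering the identity of $X$. A principal $\mathbb{T}^n\rtimes S_n$-bundle reduces to an $S_n$-bundle if it admits an atlas whose transition functions take values in the subgroup $S_n=\{(1,\sigma):\sigma\in S_n\}$. A Hermitian line bundle is a complex line bundle together with a metric, i.e. a continuous choice of inner product on the fibers. A twisted $n$-sheeted covering of $X$ is a triple $(Z,s,\mathcal{L})$ where $Z$ is a locally compact Hausdorff space, $s:Z\to X$ is a surjective covering map all of whose fibers have exactly $n$ elements, and $\mathcal{L}$ is a Hermitian line bundle with base space $Z$, called the twist. Two such triples $(Z,s,\mathcal{L})$ and $(Z',s',\mathcal{L}')$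 are isomorphic if there is a homeomorphism $\phi:Z\to Z'$ with $s'\circ\phi=s$ such that the pullback $\phi^*\mathcal{L}'$ is isomorphic to $\mathcal{L}$. The twist is trivial if $\mathcal{L}$ is isomorphic to the trivial line bundle $Z\times\mathbb{C}$. *)

(* Defs.v *)
From HB Require Import structures.
From mathcomp Require Import all_boot all_order all_algebra all_fingroup.
From mathcomp Require Import complex sesquilinear.
From mathcomp Require Import all_classical all_reals all_analysis.

Set Implicit Arguments.
Unset Strict Implicit.
Unset Printing Implicit Defensive.

Import Order.TTheory GRing.Theory Num.Theory.
Import numFieldNormedType.Exports.

Local Open Scope classical_set_scope.
Local Open Scope ring_scope.
Local Open Scope complex_scope.

HB.instance Definition _ (R : realType) := NormedModule.copy R[i] (R[i])^o.

Lemma pair_continuous_at (S T U : topologicalType) (f : S -> T) (g : S -> U) x :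
  {for x, continuous f} -> {for x, continuous g} ->
  {for x, continuous (fun x => (f x, g x))}.
Proof. by move=> cf cg; apply: cvg_pair; [exact: cf | exact: cg]. Qed.

Lemma pair_continuous (S T U : topologicalType) (f : S -> T) (g : S -> U) :
  continuous f -> continuous g -> continuous (fun x => (f x, g x)).
Proof. by move=> cf cg x; apply: cvg_pair; [exact: cf | exact: cg]. Qed.

Lemma compose_continuous (S T U : topologicalType) (f : S -> T) (g : T -> U) :
  continuous f -> continuous g -> continuous (fun x => g (f x)).
Proof. by move=> cf cg x; apply: continuous_comp; [exact: cf | exact: cg]. Qed.

Lemma fst_continuous (S T : topologicalType) : continuous (@fst S T).
Proof. by move=> x; exact: cvg_fst. Qed.

Lemma snd_continuous (S T : topologicalType) : continuous (@snd S T).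
Proof. by move=> x; exact: cvg_snd. Qed.

Lemma ptws_continuous (S T : topologicalType) (I : Type)
    (f : S -> {ptws I -> T}) :
  (forall i, continuous (fun x => f x i)) -> continuous f.
Proof.
move=> cf x; apply/cvg_sup => i; move: x.
exact: (@continuous_comp_initial _ _ _ (fun g : I -> T => g i) f (cf i)).
Qed.

Lemma coord_continuous (T : topologicalType) (I : eqType) (i : I) :
  continuous (fun g : {ptws I -> T} => g i).
Proof. exact: (@proj_continuous I (fun=> T) i). Qed.

Lemma discrete_locally_continuous (S U : topologicalType) (D : choiceType)
    (d : S -> discrete_topology D) (f : D -> S -> U) :
  continuous d -> (forall a, continuous (f a)) ->
  continuous (fun x => f (d x) x).
Proof.
move=> cd cf x A /= /(cf (d x) x) fA.
have dx : nbhs x (d @^-1` [set d x]) by apply: cd; exact/principal_filterP.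
by apply: filterS (filterI dx fA) => y /= [-> ].
Qed.

Lemma open_preimage (S T : topologicalType) (f : S -> T) (U : set T) :
  continuous f -> open U -> open (f @^-1` U).
Proof. by move=> cf oU; apply: open_comp => // x _; exact: cf. Qed.

Lemma open_setXT (S T : topologicalType) (U : set S) :
  open U -> open (U `*` [set: T]).
Proof.
move=> oU; rewrite (_ : _ `*` _ = fst @^-1` U).
  exact: open_preimage (@fst_continuous _ _) oU.
by apply/seteqP; split=> [x []|x].
Qed.

Lemma within_continuous_compose (S T U : topologicalType) (A : set S)
    (B : set T) (f : S -> T) (g : T -> U) :
  continuous f -> set_fun A B f -> {within B, continuous g} ->
  {within A, continuous (fun x => g (f x))}.
Proof.
move=> cf AB /subspace_continuousP cg; apply/subspace_continuousP => x Ax.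
move=> C /(cg _ (AB _ Ax)) /= gC.
apply: (@filterS _ (nbhs x) _ _ _ _ (cf x _ gC)) => y /= gfy Ay.
by apply: gfy; exact: AB.
Qed.

(** * Topological groups *)

HB.mixin Record isTopologicalGroup G & monoid.Group G & Topological G := {
  mulg_continuous : continuous (fun x : G * G => (x.1 * x.2)%g) ;
  invg_continuous : continuous (fun x : G => x^-1%g)
}.

#[short(type="topologicalGroupType")]
HB.structure Definition TopologicalGroup :=
  {G of isTopologicalGroup G & monoid.Group G & Topological G}.

(** * The circle group and T^n ><| S_n *)

Definition circle (R : realType) := set_type [set z : R[i] | `|z| = 1].

HB.instance Definition _ (R : realType) := Topological.on (circle R).

Section circle_group.
Variable R : realType.
Implicit Types z w : circle R.

Lemma circleP z : `|\val z| = 1. Proof. exact: (set_mem (valP z)). Qed.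

Definition to_circle (a : R[i]) (a1 : `|a| = 1) : circle R :=
  exist (fun b : R[i] => b \in [set c : R[i] | `|c| = 1]) a (mem_set a1).

Lemma circleM_subproof z w : `|\val z * \val w| = 1.
Proof. by rewrite normrM !circleP mulr1. Qed.

Lemma circleV_subproof z : `|(\val z)^-1| = 1.
Proof. by rewrite normfV circleP invr1. Qed.

Definition circle1 := to_circle (normr1 R[i]).
Definition circleM z w := to_circle (circleM_subproof z w).
Definition circleV z := to_circle (circleV_subproof z).

Lemma circleMA : associative circleM.
Proof. by move=> x y z; apply: val_inj; rewrite /= mulrA. Qed.
Lemma circle1M : left_id circle1 circleM.
Proof. by move=> x; apply: val_inj; rewrite /= mul1r. Qed.
Lemma circleM1 : right_id circle1 circleM.
Proof. by move=> x; apply: val_inj; rewrite /= mulr1. Qed.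
Lemma circle_neq0 z : \val z != 0.
Proof. by rewrite -normr_eq0 circleP oner_eq0. Qed.
Lemma circleVM : left_inverse circle1 circleV circleM.
Proof. by move=> x; apply: val_inj; rewrite /= mulVf ?circle_neq0. Qed.
Lemma circleMV : right_inverse circle1 circleV circleM.
Proof. by move=> x; apply: val_inj; rewrite /= mulfV ?circle_neq0. Qed.

HB.instance Definition _ := isGroup.Build (circle R)
  circleMA circle1M circleM1 circleVM circleMV.

Lemma val_circle_continuous : continuous (\val : circle R -> R[i]).
Proof. exact: initial_continuous. Qed.

Lemma circle_continuous (T : topologicalType) (f : T -> circle R) :
  continuous (fun t => \val (f t)) -> continuous f.
Proof. exact: continuous_comp_initial. Qed.

Lemma circle_mul_continuous :
  continuous (fun z : circle R * circle R => (z.1 * z.2)%g).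
Proof.
apply: circle_continuous.
apply: (@compose_continuous _ _ _
  (fun z : circle R * circle R => (\val z.1, \val z.2))
  (fun u : R[i] * R[i] => u.1 * u.2)); last exact: mul_continuous.
apply: pair_continuous.
  exact: compose_continuous (@fst_continuous _ _) val_circle_continuous.
exact: compose_continuous (@snd_continuous _ _) val_circle_continuous.
Qed.

Lemma circle_inv_continuous : continuous (fun z : circle R => z^-1%g).
Proof.
apply: circle_continuous => z.
apply: (@continuous_comp _ _ _ (fun z : circle R => \val z)
  (fun a : R[i] => a^-1)); first exact: val_circle_continuous.
exact: (inv_continuous (circle_neq0 z)).
Qed.

HB.instance Definition _ := isTopologicalGroup.Build (circle R)
  circle_mul_continuous circle_inv_continuous.

End circle_group.

Definition torus_sym (R : realType) (n : nat) : Type :=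
  ({ptws 'I_n -> circle R} * discrete_topology 'S_n)%type.

HB.instance Definition _ (R : realType) (n : nat) :=
  Topological.on (torus_sym R n).

Section torus_sym_group.
Variables (R : realType) (n : nat).
Implicit Types g h : torus_sym R n.

(* The product of 'S_n in MathComp composes from left to right:
   (s * t)%g x = t (s x).  Hence the composite g.2 \o h.2 is written
   (h.2 * g.2)%g. *)
Definition torus_symM g h : torus_sym R n :=
  ((fun k => (g.1 k * h.1 ((g.2 : 'S_n)^-1%g k))%g), ((h.2 : 'S_n) * (g.2 : 'S_n))%g).

Definition torus_sym1 : torus_sym R n := ((fun=> 1%g), 1%g).

Definition torus_symV g : torus_sym R n :=
  ((fun k => (g.1 ((g.2 : 'S_n) k))^-1%g), (g.2 : 'S_n)^-1%g).

Lemma torus_sym_eq g h : (forall k, g.1 k = h.1 k) -> g.2 = h.2 -> g = h.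
Proof. by case: g h => [l s] [m t] /= lm ->; congr (_, _); apply/funext. Qed.

Lemma torus_symMA : associative torus_symM.
Proof.
move=> x y z; apply: torus_sym_eq => [k|] /=; last by rewrite mulgA.
by rewrite invMg permM !mulgA.
Qed.

Lemma torus_sym1M : left_id torus_sym1 torus_symM.
Proof.
move=> x; apply: torus_sym_eq => [k|] /=; last by rewrite mulg1.
by rewrite invg1 perm1 mul1g.
Qed.

Lemma torus_symM1 : right_id torus_sym1 torus_symM.
Proof.
by move=> x; apply: torus_sym_eq => [k|] /=; [rewrite mulg1|rewrite mul1g].
Qed.

Lemma torus_symVM : left_inverse torus_sym1 torus_symV torus_symM.
Proof.
move=> x; apply: torus_sym_eq => [k|] /=; last by rewrite mulgV.
by rewrite invgK mulVg.
Qed.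

Lemma torus_symMV : right_inverse torus_sym1 torus_symV torus_symM.
Proof.
move=> x; apply: torus_sym_eq => [k|] /=; last by rewrite mulVg.
by rewrite permKV mulgV.
Qed.

HB.instance Definition _ := isGroup.Build (torus_sym R n)
  torus_symMA torus_sym1M torus_symM1 torus_symVM torus_symMV.

Lemma torus_sym_mul_continuous :
  continuous (fun x : torus_sym R n * torus_sym R n => (x.1 * x.2)%g).
Proof.
have c1 : continuous (fun x : torus_sym R n * torus_sym R n => x.1).
  exact: fst_continuous.
have c2 : continuous (fun x : torus_sym R n * torus_sym R n => x.2).
  exact: snd_continuous.
have cl : continuous (fun g : torus_sym R n => g.1) by exact: fst_continuous.
have cs : continuous (fun g : torus_sym R n => g.2) by exact: snd_continuous.
apply: pair_continuous.
  apply: ptws_continuous => k.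
  pose f (s : 'S_n) (x : torus_sym R n * torus_sym R n) : circle R :=
    (x.1.1 k * x.2.1 (s^-1%g k))%g.
  apply: (@discrete_locally_continuous _ _ _
    (fun x : torus_sym R n * torus_sym R n => x.1.2) f).
    exact: (@compose_continuous _ _ _ _ _ c1 cs).
  move=> s; apply: (@compose_continuous _ _ _
    (fun x : torus_sym R n * torus_sym R n => (x.1.1 k, x.2.1 (s^-1%g k)))
    (fun z : circle R * circle R => (z.1 * z.2)%g)); last exact: mulg_continuous.
  apply: pair_continuous.
    exact: (@compose_continuous _ _ _ _ _ (@compose_continuous _ _ _ _ _ c1 cl)
    (@coord_continuous _ _ k)).
  exact: (@compose_continuous _ _ _ _ _ (@compose_continuous _ _ _ _ _ c2 cl)
    (@coord_continuous _ _ (s^-1%g k))).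
pose f (s : 'S_n) (x : torus_sym R n * torus_sym R n) : discrete_topology 'S_n :=
  ((x.2.2 : 'S_n) * s)%g.
apply: (@discrete_locally_continuous _ _ _
    (fun x : torus_sym R n * torus_sym R n => x.1.2) f).
  exact: (@compose_continuous _ _ _ _ _ c1 cs).
move=> s; pose h (t : 'S_n) (x : torus_sym R n * torus_sym R n) :
  discrete_topology 'S_n := (t * s)%g.
apply: (@discrete_locally_continuous _ _ _
    (fun x : torus_sym R n * torus_sym R n => x.2.2) h).
  exact: (@compose_continuous _ _ _ _ _ c2 cs).
by move=> t; exact: cst_continuous.
Qed.

Lemma torus_sym_inv_continuous :
  continuous (fun x : torus_sym R n => (x^-1)%g).
Proof.
have cl : continuous (fun g : torus_sym R n => g.1) by exact: fst_continuous.
have cs : continuous (fun g : torus_sym R n => g.2) by exact: snd_continuous.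
apply: pair_continuous.
  apply: ptws_continuous => k.
  pose f (s : 'S_n) (x : torus_sym R n) : circle R := ((x.1 (s k))^-1)%g.
  apply: (@discrete_locally_continuous _ _ _ (fun x : torus_sym R n => x.2) f cs) => s.
  apply: (@compose_continuous _ _ _ (fun x : torus_sym R n => x.1 (s k))
    (fun z : circle R => z^-1%g)); last exact: invg_continuous.
  exact: (@compose_continuous _ _ _ _ _ cl (@coord_continuous _ _ (s k))).
pose f (s : 'S_n) (x : torus_sym R n) : discrete_topology 'S_n := (s^-1)%g.
apply: (@discrete_locally_continuous _ _ _ (fun x : torus_sym R n => x.2) f cs) => s.
exact: cst_continuous.
Qed.

HB.instance Definition _ := isTopologicalGroup.Build (torus_sym R n)
  torus_sym_mul_continuous torus_sym_inv_continuous.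

Definition sym_subgroup : set (torus_sym R n) := [set g | forall k, g.1 k = 1%g].

End torus_sym_group.

(** * Homeomorphisms *)

Definition mutual_homeo (S T : topologicalType) (f : S -> T) (g : T -> S) :=
  [/\ continuous f, continuous g, cancel f g & cancel g f].

(* f and g are total functions, of which only the restrictions to A and B
   matter. *)
Definition mutual_homeo_on (S T : topologicalType) (A : set S) (B : set T)
    (f : S -> T) (g : T -> S) :=
  [/\ {within A, continuous f} /\ {within B, continuous g},
      set_fun A B f, set_fun B A g,
      (forall x, A x -> g (f x) = x) & (forall y, B y -> f (g y) = y)].

(** * Principal bundles *)

Record right_gspace (G : topologicalGroupType) (X : topologicalType) :=
    RightGSpace {
  gs_total :> topologicalType ;
  gs_proj : gs_total -> X ;
  gs_act : gs_total -> G -> gs_total ;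
  gs_proj_continuous : continuous gs_proj ;
  gs_act_continuous :
    continuous (fun eg : gs_total * G => gs_act eg.1 eg.2) ;
  gs_act1 : forall e, gs_act e 1%g = e ;
  gs_actM : forall e g h, gs_act e (g * h)%g = gs_act (gs_act e g) h ;
  gs_proj_act : forall e g, gs_proj (gs_act e g) = gs_proj e
}.

Record gs_chart (G : topologicalGroupType) (X : topologicalType)
    (E : right_gspace G X) := GSChart {
  gc_dom : set X ;
  gc_map : E -> X * G ;
  gc_inv : X * G -> E ;
  gc_open : open gc_dom ;
  gc_homeo : mutual_homeo_on (@gs_proj G X E @^-1` gc_dom) (gc_dom `*` setT)
    gc_map gc_inv ;
  gc_proj : forall e, gc_dom (gs_proj e) -> (gc_map e).1 = gs_proj e ;
  gc_act : forall e g, gc_dom (gs_proj e) ->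
    (gc_map (gs_act e g)).2 = ((gc_map e).2 * g)%g
}.

Definition gs_atlas (G : topologicalGroupType) (X : topologicalType)
    (E : right_gspace G X) (A : set (gs_chart E)) :=
  forall x, exists2 c, A c & gc_dom c x.

Record principal_bundle (G : topologicalGroupType) (X : topologicalType) :=
    PrincipalBundle {
  pb_gspace :> right_gspace G X ;
  pb_locally_trivial : gs_atlas [set: gs_chart pb_gspace]
}.

Definition principal_iso (G : topologicalGroupType) (X : topologicalType)
    (P Q : principal_bundle G X) :=
  exists (f : P -> Q) (g : Q -> P),
    [/\ mutual_homeo f g,
        forall e, gs_proj (f e) = gs_proj e &
        forall e a, f (gs_act e a) = gs_act (f e) a].

(* On gc_dom c `&` gc_dom d, the map gc_map c \o gc_inv d is
   (x, g) |-> (x, transition c d x * g). *)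
Definition transition (G : topologicalGroupType) (X : topologicalType)
    (E : right_gspace G X) (c d : gs_chart E) (x : X) : G :=
  (gc_map c (gc_inv d (x, 1%g))).2.

Definition reduces_to (G : topologicalGroupType) (X : topologicalType)
    (H : set G) (P : principal_bundle G X) :=
  exists2 A : set (gs_chart P), gs_atlas A &
    forall c d x, A c -> A d -> gc_dom c x -> gc_dom d x ->
      H (transition c d x).

(** * Hermitian line bundles *)

Record line_bundle (R : realType) (Z : topologicalType) := LineBundle {
  lb_total :> topologicalType ;
  lb_proj : lb_total -> Z ;
  lb_fiber : Z -> lmodType R[i] ;
  lb_in : forall z, lb_fiber z -> lb_total ;
  lb_proj_continuous : continuous lb_proj ;
  lb_in_bij : forall z, set_bij setT (lb_proj @^-1` [set z]) (@lb_in z) ;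
  lb_locally_trivial : forall z, exists (U : set Z)
      (f : lb_total -> Z * R[i]) (g : Z * R[i] -> lb_total),
    [/\ open U /\ U z,
        mutual_homeo_on (lb_proj @^-1` U) (U `*` setT) f g,
        forall e, U (lb_proj e) -> (f e).1 = lb_proj e &
        forall y, U y -> linear (fun v : lb_fiber y => (f (lb_in v)).2 : R[i]^o)]
}.

(* Only the values of the metric on the fibre product, the pairs of points in
   the same fibre, are meaningful. *)
Record hermitian_line_bundle (R : realType) (Z : topologicalType) :=
    HermitianLineBundle {
  hlb_bundle :> line_bundle R Z ;
  hlb_metric : hlb_bundle * hlb_bundle -> R[i] ;
  hlb_metric_continuous :
    {within [set e | lb_proj e.1 = lb_proj e.2], continuous hlb_metric} ;
  hlb_metric_dot : forall z,
    exists dot : {dot lb_fiber hlb_bundle z for Num.conj},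
      forall v w, hlb_metric (lb_in v, lb_in w) = dot v w
}.

(* An isomorphism of Hermitian line bundles is an isomorphism of line bundles
   that preserves the metrics. *)
Definition hermitian_iso (R : realType) (Z : topologicalType)
    (L M : hermitian_line_bundle R Z) :=
  exists (f : L -> M) (g : M -> L),
    [/\ mutual_homeo f g,
        forall e, lb_proj (f e) = lb_proj e,
        forall z, exists l : {linear lb_fiber L z -> lb_fiber M z},
          forall v, f (lb_in v) = lb_in (l v) &
        forall e e', lb_proj e = lb_proj e' ->
          hlb_metric (f e, f e') = hlb_metric (e, e')].

Section trivial_line_bundle.
Variables (R : realType) (Z : topologicalType).

Lemma trivial_lb_in_bij z :
  set_bij setT (@fst Z R[i] @^-1` [set z]) (fun v : R[i]^o => (z, v)).
Proof.
split=> // [x y _ _ [] // | [y v] /= ->].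
by exists v.
Qed.

Lemma trivial_lb_locally_trivial z : exists (U : set Z)
    (f g : Z * R[i] -> Z * R[i]),
  [/\ open U /\ U z,
      mutual_homeo_on (fst @^-1` U) (U `*` setT) f g,
      forall e, U e.1 -> (f e).1 = e.1 &
      forall y, U y -> linear (fun v : R[i]^o => (f (y, v)).2 : R[i]^o)].
Proof.
exists setT, id, id; split=> //; first by split=> //; exact: openT.
by split=> //; split; apply: continuous_subspaceT => x.
Qed.

Definition trivial_line_bundle : line_bundle R Z :=
  @LineBundle R Z (Z * R[i])%type fst (fun=> R[i]^o) (fun z v => (z, v))
    (@fst_continuous _ _) trivial_lb_in_bij trivial_lb_locally_trivial.

Definition trivial_dot (v w : R[i]^o) : R[i] := v * Num.conj w.

Lemma trivial_dot_bilinear :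
  bilinear_for ( *%R ) (Num.conj \; *%R) trivial_dot.
Proof.
split=> [w a u v|w a u v] /=; rewrite /trivial_dot.
  by rewrite mulrDl mulrA.
by rewrite rmorphD rmorphM mulrDr mulrCA.
Qed.

HB.instance Definition _ := @bilinear_isBilinear.Build R[i] R[i]^o R[i]^o R[i]
  ( *%R ) (Num.conj \; *%R) trivial_dot trivial_dot_bilinear.

Lemma trivial_dot_hermitian v w :
  trivial_dot v w = (-1) ^+ false * Num.conj (trivial_dot w v).
Proof.
rewrite /trivial_dot expr0 mul1r rmorphM.
by rewrite [RHS]mulrC; congr (_ * _); exact: esym (conjCK v).
Qed.

HB.instance Definition _ := @isHermitianSesquilinear.Build R[i] R[i]^o false
  Num.conj trivial_dot trivial_dot_hermitian.

Lemma trivial_dot_gt0 v : v != 0 -> 0 < trivial_dot v v.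
Proof. by move=> v0; rewrite /trivial_dot -normCK exprn_gt0 ?normr_gt0. Qed.

HB.instance Definition _ := @isDotProduct.Build R[i] R[i]^o trivial_dot
  trivial_dot_gt0.

Definition trivial_metric (e : (Z * R[i]) * (Z * R[i])) : R[i] :=
  trivial_dot e.1.2 e.2.2.

Lemma conjC_continuous : continuous (fun a : R[i] => Num.conj a).
Proof.
move=> a A /nbhs_ballP [e e0 eA]; apply/nbhs_ballP; exists e => // b ab.
apply: eA; move: ab; by rewrite -!ball_normE /= -rmorphB norm_conjC.
Qed.

Lemma trivial_metric_continuous : continuous trivial_metric.
Proof.
apply: (@compose_continuous _ _ _
  (fun e : (Z * R[i]) * (Z * R[i]) => (e.1.2, Num.conj e.2.2))
  (fun u : R[i] * R[i] => u.1 * u.2)); last exact: mul_continuous.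
apply: pair_continuous.
  exact: compose_continuous (@fst_continuous _ _) (@snd_continuous _ _).
apply: (@compose_continuous _ _ _
  (fun e : (Z * R[i]) * (Z * R[i]) => e.2.2) _ _ conjC_continuous).
exact: compose_continuous (@snd_continuous _ _) (@snd_continuous _ _).
Qed.

Lemma trivial_metric_dot (z : Z) : exists dot : {dot R[i]^o for Num.conj},
  forall v w, trivial_metric ((z, v), (z, w)) = dot v w.
Proof. by exists trivial_dot. Qed.

Definition trivial_hermitian_line_bundle : hermitian_line_bundle R Z :=
  @HermitianLineBundle R Z trivial_line_bundle trivial_metric
    (continuous_subspaceT trivial_metric_continuous) trivial_metric_dot.

End trivial_line_bundle.

Lemma lb_proj_in (R : realType) (Z : topologicalType) (L : line_bundle R Z)
  z (v : lb_fiber L z) : lb_proj (lb_in v) = z.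
Proof. by have [+ _ _] := lb_in_bij L z; apply. Qed.

Section pullback.
Variables (R : realType) (Z Z' : topologicalType) (phi : Z -> Z').
Hypothesis phi_continuous : continuous phi.

Section pullback_line_bundle.
Variable L : line_bundle R Z'.

Definition pullback_set : set (Z * L) := [set u | phi u.1 = lb_proj u.2].

Definition pullback_total := set_type pullback_set.

HB.instance Definition _ := Topological.on pullback_total.

Definition to_pullback (u : Z * L) (Pu : pullback_set u) : pullback_total :=
  exist (fun u => u \in pullback_set) u (mem_set Pu).

Definition pullback_proj (e : pullback_total) : Z := (\val e).1.

Definition pullback_in z (v : lb_fiber L (phi z)) : pullback_total :=
  @to_pullback (z, lb_in v) (esym (lb_proj_in v)).

Lemma pullbackP (e : pullback_total) : phi (\val e).1 = lb_proj (\val e).2.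
Proof. exact: (set_mem (valP e)). Qed.

Lemma val_pullback_continuous : continuous (\val : pullback_total -> Z * L).
Proof. exact: initial_continuous. Qed.

Lemma pullback_proj_continuous : continuous pullback_proj.
Proof. exact: compose_continuous val_pullback_continuous (@fst_continuous _ _). Qed.

Lemma pullback_in_bij z :
  set_bij setT (pullback_proj @^-1` [set z]) (@pullback_in z).
Proof.
have [_ inj surj] := lb_in_bij L (phi z).
split=> [//|v w vT wT /(congr1 \val)/= [vw]|e /= ez].
  exact: inj.
have [|v _ ve] := surj (\val e).2; first by rewrite /= -pullbackP -ez.
exists v => //; apply: val_inj; rewrite /= ve -ez.
by rewrite /pullback_proj -surjective_pairing.
Qed.

Lemma pullback_locally_trivial z : exists (U : set Z)
    (f : pullback_total -> Z * R[i]) (g : Z * R[i] -> pullback_total),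
  [/\ open U /\ U z,
      mutual_homeo_on (pullback_proj @^-1` U) (U `*` setT) f g,
      forall e, U (pullback_proj e) -> (f e).1 = pullback_proj e &
      forall y, U y ->
        linear (fun v : lb_fiber L (phi y) => (f (pullback_in v)).2 : R[i]^o)].
Proof.
have [V [f [g [[oV Vz] [[cf cg] fV gV fK gK] fp flin]]]] :=
  lb_locally_trivial L (phi z).
pose e0 := @pullback_in z 0.
pose g' (u : Z * R[i]) : pullback_total :=
  if pselect (phi u.1 = lb_proj (g (phi u.1, u.2))) is left p
  then @to_pullback (u.1, g (phi u.1, u.2)) p else e0.
have g'E (u : Z * R[i]) : V (phi u.1) ->
    \val (g' u) = (u.1, g (phi u.1, u.2)).
  move=> Vu; rewrite /g'; case: pselect => // -[].
  have gu : V (lb_proj (g (phi u.1, u.2))) by apply: gV.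
  by rewrite -fp // gK.
have Ve (e : pullback_total) : V (phi (pullback_proj e)) ->
    V (lb_proj (\val e).2) by rewrite -pullbackP.
have oW : open (@lb_proj R Z' L @^-1` V).
  exact: open_preimage (@lb_proj_continuous _ _ L) oV.
have oU : open (phi @^-1` V) by exact: open_preimage.
move: cf cg; rewrite (continuous_open_subspace _ oW).
rewrite (continuous_open_subspace _ (open_setXT oV)) => cf cg.
exists (phi @^-1` V), (fun e => (pullback_proj e, (f (\val e).2).2)), g'.
split => //; first split=> //.
  + split.
      rewrite continuous_open_subspace; last first.
        exact: open_preimage pullback_proj_continuous oU.
      move=> e /set_mem /= Vpe.
      apply: (@pair_continuous_at _ _ _ pullback_proj (fun e => (f (\val e).2).2)).
        exact: pullback_proj_continuous.
      apply: (@continuous_comp _ _ _ (fun e : pullback_total => (\val e).2)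
        (fun w => (f w).2)).
        exact: (compose_continuous val_pullback_continuous (@snd_continuous _ _)).
      apply: (@continuous_comp _ _ _ f snd); last exact: snd_continuous.
      by apply: cf; rewrite inE; exact: Ve.
    apply: continuous_comp_initial.
    apply: (@subspace_eq_continuous _ _ _
      (fun u : Z * R[i] => (u.1, g (phi u.1, u.2)))).
      by move=> u /set_mem [Vu _]; rewrite -g'E.
    rewrite (continuous_open_subspace _ (open_setXT oU)) => u /set_mem [/= Vu _].
    apply: (@pair_continuous_at _ _ _ fst (fun u => g (phi u.1, u.2))).
      exact: fst_continuous.
    apply: (@continuous_comp _ _ _ (fun u : Z * R[i] => (phi u.1, u.2)) g).
      apply: (@pair_continuous_at _ _ _ (fun u => phi u.1) snd);
        last exact: snd_continuous.
      exact: (compose_continuous (@fst_continuous _ _) phi_continuous).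
    by apply: cg; rewrite inE.
  + by move=> u [/= Vu _]; rewrite /pullback_proj g'E.
  + move=> e /= Vpe; apply: val_inj; rewrite g'E //= /pullback_proj.
    rewrite pullbackP -[lb_proj _]fp; last exact: Ve.
    by rewrite -surjective_pairing fK; [rewrite -surjective_pairing | exact: Ve].
  + move=> [y c] [/= Vy _]; rewrite /pullback_proj.
    rewrite -[sval (g' _)]/(\val (g' (y, c))) (g'E (y, c) Vy) gK //.
- by move=> y Vy; exact: flin.
Qed.

Definition pullback_line_bundle : line_bundle R Z :=
  @LineBundle R Z pullback_total pullback_proj
    (fun z => lb_fiber L (phi z)) pullback_in
    pullback_proj_continuous pullback_in_bij pullback_locally_trivial.

End pullback_line_bundle.

Section pullback_hermitian.
Variable L : hermitian_line_bundle R Z'.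

Definition pullback_metric
    (e : pullback_line_bundle L * pullback_line_bundle L) : R[i] :=
  hlb_metric ((\val e.1).2, (\val e.2).2).

Lemma pullback_metric_continuous :
  {within [set e | lb_proj e.1 = lb_proj e.2], continuous pullback_metric}.
Proof.
apply: (@within_continuous_compose _ _ _ _ _
  (fun e : pullback_line_bundle L * pullback_line_bundle L =>
    ((\val e.1).2, (\val e.2).2)) _ _ _ (@hlb_metric_continuous _ _ L)).
  have cv := compose_continuous (@val_pullback_continuous L)
    (@snd_continuous _ _).
  apply: pair_continuous.
    exact: (compose_continuous (@fst_continuous _ _) cv).
  exact: (compose_continuous (@snd_continuous _ _) cv).
move=> e /= ee; rewrite -!pullbackP; congr phi; exact: ee.
Qed.

Lemma pullback_metric_dot z :
  exists dot : {dot lb_fiber (pullback_line_bundle L) z for Num.conj},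
    forall v w, pullback_metric (lb_in v, lb_in w) = dot v w.
Proof. exact: hlb_metric_dot. Qed.

Definition pullback : hermitian_line_bundle R Z :=
  @HermitianLineBundle R Z (pullback_line_bundle L) pullback_metric
    pullback_metric_continuous pullback_metric_dot.

End pullback_hermitian.
End pullback.

(** * Twisted coverings *)

Definition evenly_covered (Z X : topologicalType) (s : Z -> X) (U : set X) :=
  exists V : set (set Z),
    [/\ forall W, V W -> open W,
        trivIset V id,
        s @^-1` U = \bigcup_(W in V) W &
        forall W, V W -> exists t : X -> Z, mutual_homeo_on W U s t].

Definition covering_map (Z X : topologicalType) (s : Z -> X) :=
  continuous s /\
  forall x, exists U : set X, [/\ open U, U x & evenly_covered s U].

Record twisted_covering (R : realType) (X : topologicalType) (n : nat) :=
    TwistedCovering {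
  tc_space : topologicalType ;
  tc_map : tc_space -> X ;
  tc_twist : hermitian_line_bundle R tc_space ;
  tc_locally_compact : locally_compact [set: tc_space] ;
  tc_hausdorff : hausdorff_space tc_space ;
  tc_covering : covering_map tc_map ;
  tc_surjective : set_surj setT setT tc_map ;
  tc_sheets : forall x, (tc_map @^-1` [set x] #= `I_n)%card
}.

Definition twisted_iso (R : realType) (X : topologicalType) (n : nat)
    (T T' : twisted_covering R X n) :=
  exists (phi : tc_space T -> tc_space T') (psi : tc_space T' -> tc_space T)
    (phi_continuous : continuous phi),
    [/\ mutual_homeo phi psi,
        forall z, tc_map (phi z) = tc_map z &
        hermitian_iso (pullback phi_continuous (tc_twist T')) (tc_twist T)].

Definition trivial_twist (R : realType) (X : topologicalType) (n : nat)
    (T : twisted_covering R X n) :=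
  hermitian_iso (tc_twist T) (trivial_hermitian_line_bundle R (tc_space T)).

(** * Isomorphism classes *)

(* The type of the classes of a relation, as subsets of T.  The library's set
   and range are not used here since their universe is too small to contain
   the types of bundles and coverings. *)
Record iso_classes (T : Type) (iso : T -> T -> Prop) := IsoClass {
  class_pred : T -> Prop ;
  class_predP : exists t, class_pred = iso t
}.

Definition class_of (T : Type) (iso : T -> T -> Prop) (t : T) :
    iso_classes iso :=
  @IsoClass T iso (iso t) (@ex_intro T (fun u => iso t = iso u) t erefl).

(* Main.v *)
Require Import Defs.
From HB Require Import structures.
From mathcomp Require Import all_boot all_order all_algebra all_fingroup.
From mathcomp Require Import complex sesquilinear.
From mathcomp Require Import all_classical all_reals all_analysis.

(* A twisted covering (Z, s, L) has a bundle of unitary frames, whose fibre over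
   x consists of the families of n unit vectors of L lying over the n distinct
   points of s^-1(x); T^n ><| S_n acts simply transitively on each fibre.
   Conversely a principal bundle P has the associated covering (P x 'I_n) / G
   with twist (P x 'I_n x C) / G.  Rather than compare the two constructions, we
   call T and P associated when there is a continuous injective equivariant map
   q from P to the frames of T.  In an associated pair each member determines
   the other up to isomorphism: two frames over the same point differ by a
   unique element of G, which depends continuously on the frames since lifts
   through a covering that agree at a point agree near it.  A unit section r of L
   trivializes the twist; it yields the atlas of the local sections of P whose
   frames take their values in r, and the transitions between these lie in
   S_n. *)

Set Implicit Arguments.
Unset Strict Implicit.
Unset Printing Implicit Defensive.

Import Order.TTheory GRing.Theory Num.Theory.
Import numFieldNormedType.Exports.

Local Open Scope classical_set_scope.
Local Open Scope ring_scope.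
Local Open Scope complex_scope.

(** * Continuity at a point *)

(** Working with the relation [associated] avoids composing the two constructions: the bijection of
    classes follows once every covering and every bundle has a partner, and partners of isomorphic
    objects are isomorphic. A framing is defined on any G-space, so that the local triviality of the
    frame bundle can itself be derived from its framing; injectivity of the framing then makes G
    transitive on the fibres of the G-space. The obstacle in the other construction is to give the
    quotients by G a carrier and a topology. A pointwise choice of charts, without any continuity,
    fixes the carriers; the topologies are final, and continuity is checked in the coordinates of
    one chart, where the arbitrary choice cancels. *)

Lemma near_eq_continuous_at (S T : topologicalType) (f g : S -> T) x :
  (\forall y \near x, f y = g y) -> {for x, continuous g} ->
  {for x, continuous f}.
Proof.
move=> fg cg A; rewrite (nbhs_singleton fg) => /cg gA.
by apply: (@filterS _ (nbhs x) _ _ _ _ (filterI fg gA)) => y [/= + +] => ->.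
Qed.

Lemma set_type_continuous_at (S T : topologicalType) (A : set T)
    (f : S -> set_type A) x :
  {for x, continuous (fun y => \val (f y))} -> {for x, continuous f}.
Proof.
move=> cf V [_ [[C oC <-] Cfx] CV].
have /cf fC := open_nbhs_nbhs (conj oC Cfx).
by apply: (@filterS _ (nbhs x) _ _ _ _ fC) => y; exact: CV.
Qed.

Lemma ptws_continuous_at (S T : topologicalType) (I : Type)
    (f : S -> {ptws I -> T}) x :
  (forall i, {for x, continuous (fun y => f y i)}) -> {for x, continuous f}.
Proof.
move=> cf; apply/cvg_sup => i V [_ [[C oC <-] Cfx] CV].
have fC := cf i _ (open_nbhs_nbhs (conj oC Cfx)).
by apply: (@filterS _ (nbhs x) _ _ _ _ fC) => y; exact: CV.
Qed.

Lemma comp_continuous_at (S T U : topologicalType) (f : S -> T) (g : T -> U) x :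
  {for x, continuous f} -> {for f x, continuous g} ->
  {for x, continuous (fun y => g (f y))}.
Proof. exact: continuous_comp. Qed.

Lemma within_continuous_at (S T U : topologicalType) (A : set T) (f : S -> T)
    (g : T -> U) x :
  {within A, continuous g} -> (\forall y \near x, A (f y)) ->
  {for x, continuous f} -> {for x, continuous (fun y => g (f y))}.
Proof.
move=> /subspace_continuousP cg Af cf V /(cg _ (nbhs_singleton Af)) gV.
apply: (@filterS _ (nbhs x) _ _ _ _ (filterI Af (cf _ gV))) => y [Afy].
exact.
Qed.

Lemma open_within_continuousP (S T : topologicalType) (A : set S) (f : S -> T) :
  open A ->
  {within A, continuous f} <-> (forall x, A x -> {for x, continuous f}).
Proof.
move=> oA; rewrite continuous_open_subspace //.
by split=> cf x; [move=> Ax; apply: cf; rewrite inE | rewrite inE; exact: cf].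
Qed.

Lemma mulC_continuous_at (R : realType) (S : topologicalType)
    (f g : S -> R[i]) x :
  {for x, continuous f} -> {for x, continuous g} ->
  {for x, continuous (fun y => f y * g y : R[i])}.
Proof.
move=> cf cg.
have cfg := pair_continuous_at cf cg.
have cm : continuous (fun u : R[i] * R[i] => u.1 * u.2 : R[i]).
  exact: mul_continuous.
have := @comp_continuous_at _ _ _ _ (fun u : R[i] * R[i] => u.1 * u.2 : R[i]) x cfg.
move=> /(_ (cm _)) h.
exact: h.
Qed.

(** The difference of the roots times their sum is [f x - f y], and the sum is at least
    [sqrtC (f x)]; hence the tolerance [e * sqrtC (f x)]. *)
Lemma sqrtC_continuous_at (R : realType) (S : topologicalType)
    (f : S -> R[i]) x :
  {for x, continuous f} -> 0 < f x -> (\forall y \near x, 0 <= f y) ->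
  {for x, continuous (fun y => sqrtC (f y) : R[i])}.
Proof.
move=> cf fx0 f0; have sx0 : 0 < sqrtC (f x) by rewrite sqrtC_gt0.
apply/cvgrPdist_lt => e e0.
have e'0 : 0 < e * sqrtC (f x) by rewrite mulr_gt0.
have /cvgrPdist_lt/(_ _ e'0) fe := cf.
apply: (@filterS _ (nbhs x) _ _ _ _ (filterI f0 fe)) => y [fy0 /= fxy].
rewrite /= -(ltr_pM2r sx0); apply: le_lt_trans fxy.
rewrite -[X in _ <= `|X - _|]sqrtCK -[X in _ <= `|_ - X|]sqrtCK.
rewrite subr_sqr normrM ler_wpM2l // ger0_norm ?lerDl ?addr_ge0 ?sqrtC_ge0 //.
exact: ltW.
Qed.

(** * Line bundles *)

Section line_bundle.
Variables (R : realType) (Z : topologicalType) (L : line_bundle R Z).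
Implicit Types (w : L) (a : R[i]).

Lemma lb_vec_ex w : exists v : lb_fiber L (lb_proj w), lb_in v = w.
Proof. by have [_ _ /(_ w erefl) [v _ vw]] := lb_in_bij L (lb_proj w); exists v. Qed.

Definition lb_vec w : lb_fiber L (lb_proj w) := sval (cid (lb_vec_ex w)).

Lemma lb_vecK w : lb_in (lb_vec w) = w.
Proof. by rewrite /lb_vec; case: cid. Qed.

Lemma lb_in_inj z : injective (@lb_in _ _ L z).
Proof. by have [_ + _] := lb_in_bij L z => h v w; apply: h; rewrite inE. Qed.

Lemma lb_inP w z : lb_proj w = z -> exists v : lb_fiber L z, w = lb_in v.
Proof. by move=> <-; exists (lb_vec w); rewrite lb_vecK. Qed.

(** Scalar multiplication lives on the total space, so that vectors are compared without casts
    between the dependent types [lb_fiber L z]. *)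
Definition lb_scale a w : L := lb_in (a *: lb_vec w).

Lemma lb_scale_in a z (v : lb_fiber L z) : lb_scale a (lb_in v) = lb_in (a *: v).
Proof.
rewrite /lb_scale; move: (lb_vec _) (lb_vecK (lb_in v)).
by rewrite (lb_proj_in v) => u /lb_in_inj ->.
Qed.

Lemma lb_proj_scale a w : lb_proj (lb_scale a w) = lb_proj w.
Proof. exact: lb_proj_in. Qed.

Lemma lb_scale1 w : lb_scale 1 w = w.
Proof. by rewrite /lb_scale scale1r lb_vecK. Qed.

Lemma lb_scaleA a b w : lb_scale a (lb_scale b w) = lb_scale (a * b) w.
Proof. by rewrite {2 3}/lb_scale lb_scale_in scalerA. Qed.

Lemma lb_trivialization z : exists (U : set Z) (f : L -> R[i])
    (g : Z * R[i] -> L),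
  [/\ open U /\ U z,
      forall e, U (lb_proj e) -> {for e, continuous f},
      forall p, U p.1 -> {for p, continuous g},
      forall p, U p.1 -> lb_proj (g p) = p.1 /\ f (g p) = p.2 &
      (forall e, U (lb_proj e) -> g (lb_proj e, f e) = e) /\
      (forall a e, U (lb_proj e) -> f (lb_scale a e) = a * f e)].
Proof.
have [U [f [g [[oU Uz] [[cf cg] fU gU fK gK] fp flin]]]] := lb_locally_trivial L z.
have oLU : open (@lb_proj _ _ L @^-1` U).
  exact: open_preimage (@lb_proj_continuous _ _ L) oU.
move: cf cg; rewrite (open_within_continuousP _ oLU).
rewrite (open_within_continuousP _ (open_setXT oU)) => cf cg.
exists U, (fun e => (f e).2), g; split; first by split.
- move=> e Ue; apply: comp_continuous_at; first exact: cf.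
  exact: snd_continuous.
- by move=> p Up; apply: cg.
- move=> p Up; have gp : U (lb_proj (g p)) by apply: gU.
  by rewrite -fp // gK.
- split=> [e Ue|a e Ue]; first by rewrite -fp // -surjective_pairing fK.
  pose F (v : lb_fiber L (lb_proj e)) : R[i]^o := (f (lb_in v)).2.
  have FP b u v : F (b *: u + v) = b *: F u + F v by exact: flin.
  have F0 : F 0 = 0 by have := FP (-1) 0 0; rewrite scaler0 addr0 scaleN1r addNr.
  have := FP a (lb_vec e) 0; rewrite addr0 F0 addr0 /F lb_vecK => h.
  exact: h.
Qed.

(** In a local trivialization scaling is multiplication of the coordinate. *)
Lemma lb_scale_continuous_at (S : topologicalType) (a : S -> R[i]) (w : S -> L) s :
  {for s, continuous a} -> {for s, continuous w} ->
  {for s, continuous (fun t => lb_scale (a t) (w t))}.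
Proof.
move=> ca cw.
have [U [f [g [[oU Uz] cf cg fg [gf flin]]]]] := lb_trivialization (lb_proj (w s)).
have cpw : {for s, continuous (fun t => lb_proj (w t))}.
  by apply: comp_continuous_at cw _; exact: lb_proj_continuous.
have Uw : \forall t \near s, U (lb_proj (w t)).
  by apply: cpw; exact: open_nbhs_nbhs.
apply: (@near_eq_continuous_at _ _ _ (fun t => g (lb_proj (w t), a t * f (w t)))).
  apply: filterS Uw => t Uwt.
  by rewrite -[LHS]gf ?lb_proj_scale // flin.
apply: comp_continuous_at; last by apply: cg.
apply: pair_continuous_at cpw _.
apply: mulC_continuous_at; first exact: ca.
by apply: comp_continuous_at cw _; exact: cf.
Qed.

(** The coordinate of a trivialization is injective and homogeneous on the fibre, so the scalar is
    the quotient of the two coordinates. *)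
Lemma lb_colinear z (v u : lb_fiber L z) : u != 0 -> exists a, v = a *: u.
Proof.
move=> u0.
have [U [f [g [[oU Uz] cf cg fg [gf flin]]]]] := lb_trivialization z.
pose F (x : lb_fiber L z) : R[i]^o := f (lb_in x).
have FZ a x : F (a *: x) = a * F x.
  by rewrite /F -lb_scale_in flin ?lb_proj_in.
have F0 : F 0 = 0 by rewrite -(scale0r 0) FZ mul0r.
have Finj : injective F.
  move=> x y Fxy; apply: lb_in_inj; rewrite -[LHS]gf ?lb_proj_in //.
  by rewrite -[RHS]gf ?lb_proj_in //; congr (g (_, _)).
have Fu0 : F u != 0 by apply: contra u0 => /eqP Fu; apply/eqP/Finj; rewrite F0.
by exists (F v / F u); apply: Finj; rewrite FZ divfK.
Qed.

End line_bundle.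

(** * Unit vectors and local unit sections of Hermitian line bundles *)

Section hermitian_line_bundle.
Variables (R : realType) (Z : topologicalType) (L : hermitian_line_bundle R Z).
Implicit Types (w : L) (a : R[i]).

(** Puts both vectors into one fibre type, where [hlb_metric_dot] applies to them. *)
Lemma lb_pairP w w' : lb_proj w = lb_proj w' ->
  exists z (v v' : lb_fiber L z), w = lb_in v /\ w' = lb_in v'.
Proof.
move=> /lb_inP[v ->]; exists (lb_proj w'), v, (lb_vec w').
by rewrite lb_vecK.
Qed.

Lemma metric_scalel a w w' : lb_proj w = lb_proj w' ->
  hlb_metric (lb_scale a w, w') = a * hlb_metric (w, w').
Proof.
move=> /lb_pairP[z [v [v' [-> ->]]]]; have [dot dotE] := hlb_metric_dot L z.
by rewrite lb_scale_in !dotE linearZl_LR.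
Qed.

Lemma metric_scaler a w w' : lb_proj w = lb_proj w' ->
  hlb_metric (w, lb_scale a w') = Num.conj a * hlb_metric (w, w').
Proof.
move=> /lb_pairP[z [v [v' [-> ->]]]]; have [dot dotE] := hlb_metric_dot L z.
by rewrite lb_scale_in !dotE linearZr_LR.
Qed.

Lemma metric_ge0 w : 0 <= hlb_metric (w, w).
Proof.
have [z [v [_ [-> _]]]] := lb_pairP (erefl (lb_proj w)).
by have [dot dotE] := hlb_metric_dot L z; rewrite dotE dnorm_ge0.
Qed.

(** [lb_scale 0 w] is the zero vector of the fibre of [w], so the hypothesis says that [w] is not
    zero. *)
Lemma metric_gt0 w : lb_scale 0 w <> w -> 0 < hlb_metric (w, w).
Proof.
have [z [v [_ [-> _]]]] := lb_pairP (erefl (lb_proj w)).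
have [dot dotE] := hlb_metric_dot L z; rewrite dotE dnorm_gt0 lb_scale_in => w0.
by apply/eqP => v0; apply: w0; rewrite v0 scaler0.
Qed.

(** The fibre is a line, so [w] is a multiple of the unit vector [w']; pairing with [w'] reveals the
    coefficient. *)
Lemma metric_coord w w' : lb_proj w = lb_proj w' -> hlb_metric (w', w') = 1 ->
  w = lb_scale (hlb_metric (w, w')) w'.
Proof.
move=> ww' w'1; have [a wE] : exists a, w = lb_scale a w'.
  have [z [v [v' [vw v'w']]]] := lb_pairP ww'.
  have : v' != 0.
    apply/eqP => v0; have [dot dotE] := hlb_metric_dot L z.
    move: w'1; rewrite v'w' dotE v0 linear0l => /eqP.
    by rewrite eq_sym oner_eq0.
  move=> /(lb_colinear v)[a va]; exists a.
  by rewrite vw v'w' va lb_scale_in.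
by rewrite {2}wE metric_scalel // w'1 mulr1.
Qed.

Lemma metric_unit w w' : lb_proj w = lb_proj w' -> hlb_metric (w, w) = 1 ->
  hlb_metric (w', w') = 1 -> `|hlb_metric (w, w')| = 1.
Proof.
move=> ww' w1 w'1; have wE := metric_coord ww' w'1.
have : hlb_metric (w, w) = `|hlb_metric (w, w')| ^+ 2.
  rewrite {1 2}wE metric_scalel ?lb_proj_scale // metric_scaler // w'1 mulr1.
  by rewrite normCK.
rewrite w1 => /esym/eqP; rewrite sqrp_eq1 ?normr_ge0 // => /eqP.
exact.
Qed.

Lemma metric_scale_circle (c : circle R) w :
  hlb_metric (lb_scale (\val c) w, lb_scale (\val c) w) = hlb_metric (w, w).
Proof.
rewrite metric_scalel ?lb_proj_scale // metric_scaler // mulrA -normCK.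
by rewrite circleP expr1n mul1r.
Qed.

Lemma metric_continuous_at (S : topologicalType) (a b : S -> L) s :
  {for s, continuous a} -> {for s, continuous b} ->
  (\forall t \near s, lb_proj (a t) = lb_proj (b t)) ->
  {for s, continuous (fun t => hlb_metric (a t, b t))}.
Proof.
move=> ca cb ab; have cab := pair_continuous_at ca cb.
have := @within_continuous_at _ _ _ _ (fun t => (a t, b t)) _ s
  (@hlb_metric_continuous _ _ L) ab cab.
exact.
Qed.

(** The vectors of coordinate 1 in a trivialization form a nowhere vanishing section [h]; dividing
    it by its length makes it a unit section. *)
Lemma lb_unit_section z : exists (U : set Z) (r : Z -> L),
  [/\ open U, U z, forall y, U y -> {for y, continuous r} &
      forall y, U y -> lb_proj (r y) = y /\ hlb_metric (r y, r y) = 1].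
Proof.
have [U [f [g [[oU Uz] cf cg fg [gf flin]]]]] := lb_trivialization L z.
pose h y : L := g (y, 1).
have gp y : U y -> lb_proj (h y) = y /\ f (h y) = 1.
  by move=> Uy; have := fg (y, 1) Uy.
have h_gt0 y : U y -> 0 < hlb_metric (h y, h y).
  move=> Uy; have [py fy] := gp _ Uy; apply: metric_gt0 => hy0.
  have := flin 0 (h y); rewrite py hy0 fy => /(_ Uy) /eqP.
  by rewrite mul0r oner_eq0.
have ch y : U y -> {for y, continuous h}.
  move=> Uy; have cy : {for y, continuous (fun y : Z => (y, 1 : R[i]))}.
    have ci : {for y, continuous (fun y : Z => y)} by [].
    have c1 : {for y, continuous (fun _ : Z => 1 : R[i])} by exact: cvg_cst.
    exact: (pair_continuous_at ci c1).
  have := @comp_continuous_at _ _ _ (fun y : Z => (y, 1 : R[i])) g y cy.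
  by apply; exact: cg.
pose c y := (sqrtC (hlb_metric (h y, h y)))^-1.
exists U, (fun y => lb_scale (c y) (h y)); split=> // y Uy.
- apply: lb_scale_continuous_at (ch _ Uy).
  have cs : {for y, continuous (fun y => sqrtC (hlb_metric (h y, h y)) : R[i])}.
    have cm : {for y, continuous (fun y => hlb_metric (h y, h y))}.
      by apply: metric_continuous_at; [exact: ch|exact: ch|exact: nearW].
    apply: (sqrtC_continuous_at cm (h_gt0 _ Uy)).
    by apply: nearW => t; exact: metric_ge0.
  have := @comp_continuous_at _ _ _ _ (fun a : R[i] => a^-1) y cs.
  apply; apply: inv_continuous; rewrite sqrtC_eq0 gt_eqF //.
  exact: h_gt0.
- rewrite lb_proj_scale; split; first by have [] := gp _ Uy.
  have h0 := h_gt0 _ Uy.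
  rewrite metric_scalel ?lb_proj_scale // metric_scaler // mulrA.
  rewrite geC0_conj ?invr_ge0 ?sqrtC_ge0 ?(ltW h0) //.
  by rewrite -invfM -expr2 sqrtCK mulVf // gt_eqF.
Qed.

End hermitian_line_bundle.

(** * Coverings *)

(** The part of the covering property on which local uniqueness of lifts rests. *)
Definition locally_injective (Z X : topologicalType) (s : Z -> X) :=
  forall z, exists W, [/\ open W, W z & {in W &, injective s}].

Lemma covering_locally_injective (Z X : topologicalType) (s : Z -> X) :
  covering_map s -> locally_injective s.
Proof.
move=> [_ cov] z; have [U [oU Uz [V [oV _ sU hV]]]] := cov (s z).
have : (s @^-1` U) z by []; rewrite sU => -[W VW Wz].
exists W; split=> //; first exact: oV.
have [t [_ _ _ tK _]] := hV _ VW.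
move=> y y'; rewrite !inE => Wy Wy' sy.
by rewrite -(tK _ Wy) sy tK.
Qed.

(** Near [t] both lifts stay in one open set on which [s] is injective. *)
Lemma lifts_agree (S Z X : topologicalType) (s : Z -> X) (a b : S -> Z) t :
  locally_injective s -> {for t, continuous a} -> {for t, continuous b} ->
  a t = b t -> (\forall y \near t, s (a y) = s (b y)) ->
  \forall y \near t, a y = b y.
Proof.
move=> s_inj ca cb ab sab; have [W [oW Wz Winj]] := s_inj (a t).
have Wa : \forall y \near t, W (a y) by apply: ca; exact: open_nbhs_nbhs.
have Wb : \forall y \near t, W (b y).
  by apply: cb; rewrite -ab; exact: open_nbhs_nbhs.
apply: filterS3 Wa Wb sab => y Way Wby; apply: Winj; exact: mem_set.
Qed.

(** * Frames *)

Section frames.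
Variables (R : realType) (X : topologicalType) (n : nat).
Variable T : twisted_covering R X n.
Local Notation L := (tc_twist T).
Local Notation G := (torus_sym R n).
Implicit Types (x : X) (u v : 'I_n -> L) (g h : G).

Definition is_frame x u :=
  [/\ forall k, tc_map (lb_proj (u k)) = x, injective (fun k => lb_proj (u k)) &
      forall k, hlb_metric (u k, u k) = 1].

(** For g = (λ, σ) this is (λu) ∘ σ. It is a right action because the product with (μ, τ) has
    coordinates λ_m μ_{σ^{-1}(m)}, to be read at m = σ(τ(k)). *)
Definition frame_act u g : 'I_n -> L :=
  fun k => lb_scale (\val (g.1 ((g.2 : 'S_n) k))) (u ((g.2 : 'S_n) k)).

Lemma frame_act1 u : frame_act u 1%g = u.
Proof. by apply/funext => k; rewrite /frame_act /= lb_scale1 perm1. Qed.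

Lemma frame_actM u g h : frame_act u (g * h)%g = frame_act (frame_act u g) h.
Proof.
apply/funext => k; rewrite /frame_act /= lb_scaleA permM permK.
by rewrite [X in lb_scale X]mulrC.
Qed.

Lemma is_frame_act x u g : is_frame x u -> is_frame x (frame_act u g).
Proof.
case=> ux uinj u1; split=> [k|k k'|k]; rewrite /frame_act ?lb_proj_scale //.
  by move=> /uinj /perm_inj.
by rewrite metric_scale_circle.
Qed.

Lemma fibre_enum x : exists2 z : 'I_n -> tc_space T, injective z &
  forall y, tc_map y = x <-> exists k, z k = y.
Proof.
have /card_bijP[f [f' fK f'K]] := card_eq_trans (tc_sheets T x) card_II.
pose z (k : 'I_n) := \val (f' (exist _ k (in_setT k))).
exists z => [k k' /val_inj /(can_inj f'K)[]//|y].
split=> [yx|[k <-]]; last by have /set_mem := valP (f' (exist _ k (in_setT k))).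
pose Y : (tc_map (t:=T) @^-1` [set x]) := exist _ y (mem_set yx).
exists (\val (f Y)); rewrite /z (_ : exist _ _ _ = f Y); last exact: val_inj.
by rewrite fK.
Qed.

(** A frame has n distinct base points in a fibre of n elements: compared with an enumeration of the
    fibre they give an injection of ['I_n] into itself, which is onto. *)
Lemma frame_onto x u y : is_frame x u -> tc_map y = x ->
  exists k, lb_proj (u k) = y.
Proof.
move=> [ux uinj _]; have [z zinj zx] := fibre_enum x.
have ex k : exists j, z j = lb_proj (u k) by apply/zx.
pose f k := sval (cid (ex k)).
have fE k : z (f k) = lb_proj (u k) by rewrite /f; case: cid.
have finj : injective f by move=> k k' ff; apply: uinj; rewrite -!fE ff.
move=> /zx[j <-]; exists (invF finj j).
by rewrite -fE f_invF.
Qed.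

(** The base points determine the permutation, and pairing with [u m] then recovers the coordinate
    of index [m]. *)
Lemma frame_act_inj x u g h : is_frame x u -> frame_act u g = frame_act u h ->
  g = h.
Proof.
move=> [_ uinj u1] gh.
have gh2 k : (g.2 : 'S_n) k = (h.2 : 'S_n) k.
  by apply: uinj; have := congr1 (fun v => lb_proj (v k)) gh; rewrite !lb_proj_scale.
apply: torus_sym_eq; last exact/permP.
move=> m; apply: val_inj; have := congr1 (fun v => v ((g.2 : 'S_n)^-1 m)%g) gh.
rewrite /frame_act -gh2 permKV => /(congr1 (fun w => hlb_metric (w, u m))).
by rewrite !metric_scalel // u1 !mulr1.
Qed.

(** For unit vectors of the same line, the scalar of modulus 1 that takes [w'] to [w]; the default
    [1] only makes the function total. *)
Definition phase (w w' : L) : circle R :=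
  if pselect (`|hlb_metric (w, w')| = 1) is left p then to_circle p else 1%g.

Lemma phaseE w w' : lb_proj w = lb_proj w' -> hlb_metric (w, w) = 1 ->
  hlb_metric (w', w') = 1 -> \val (phase w w') = hlb_metric (w, w').
Proof. by move=> ww' w1 w'1; rewrite /phase; case: pselect => // -[]; exact: metric_unit. Qed.

(** The coordinate of index [m] multiplies [u m], which the action moves to place [s^-1 m]; hence it
    must be the phase of [v (s^-1 m)] relative to [u m]. *)
Lemma frame_act_phase x u v (s : 'S_n) : is_frame x u -> is_frame x v ->
  (forall k, lb_proj (v k) = lb_proj (u (s k))) ->
  frame_act u ((fun m => phase (v (s^-1%g m)) (u m)), s) = v.
Proof.
move=> [_ _ u1] [_ _ v1] vu; apply/funext => k; rewrite /frame_act /= permK.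
by rewrite phaseE // -metric_coord.
Qed.

Lemma frame_transitive x u v : is_frame x u -> is_frame x v ->
  exists g, frame_act u g = v.
Proof.
move=> fu fv; have [vx vinj v1] := fv.
have ex k : exists j, lb_proj (u j) = lb_proj (v k) by exact: frame_onto fu _.
pose f k := sval (cid (ex k)).
have fE k : lb_proj (u (f k)) = lb_proj (v k) by rewrite /f; case: cid.
have finj : injective f by move=> k k' ff; apply: vinj; rewrite -!fE ff.
exists ((fun m => phase (v ((perm finj)^-1%g m)) (u m)), perm finj).
by apply: (frame_act_phase fu fv) => k; rewrite permE fE.
Qed.

(** The division map of the simply transitive action on the frames over a point, with default [1]
    for families that are not in one orbit. *)
Definition frame_div u v : G :=
  if pselect (exists g, frame_act u g = v) is left p then sval (cid p) else 1%g.

Lemma frame_divK x u v : is_frame x u -> is_frame x v ->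
  frame_act u (frame_div u v) = v.
Proof.
move=> fu fv; rewrite /frame_div; case: pselect => [p|[]]; last first.
  exact: frame_transitive fu fv.
by case: cid.
Qed.

Lemma frame_div_eq x u v g : is_frame x u -> frame_act u g = v ->
  frame_div u v = g.
Proof.
move=> fu <-; apply: (frame_act_inj fu); apply: (frame_divK fu).
exact: is_frame_act.
Qed.

Lemma frame_div_continuous_at (S : topologicalType) (b : S -> X)
    (u v : S -> 'I_n -> L) s :
  (forall k, {for s, continuous (fun t => u t k)}) ->
  (forall k, {for s, continuous (fun t => v t k)}) ->
  (\forall t \near s, is_frame (b t) (u t) /\ is_frame (b t) (v t)) ->
  {for s, continuous (fun t => frame_div (u t) (v t))}.
Proof.
move=> cu cv fuv; pose g := frame_div (u s) (v s); pose sg : 'S_n := g.2.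
have [fus fvs] := nbhs_singleton fuv.
have cpu k : {for s, continuous (fun t => lb_proj (u t k))}.
  by apply: comp_continuous_at (cu k) _; exact: lb_proj_continuous.
have cpv k : {for s, continuous (fun t => lb_proj (v t k))}.
  by apply: comp_continuous_at (cv k) _; exact: lb_proj_continuous.
have agree k : \forall t \near s, lb_proj (v t k) = lb_proj (u t (sg k)).
  apply: (lifts_agree (covering_locally_injective (tc_covering T))) (cpv k) (cpu _) _ _.
    by rewrite -{1}(frame_divK fus fvs) lb_proj_scale.
  by apply: filterS fuv => t [[ux _ _] [vx _ _]]; rewrite ux vx.
have agrees : \forall t \near s, forall k, lb_proj (v t k) = lb_proj (u t (sg k)).
  exact: filter_forall.
(* The permutation is now frozen at its value [sg] at [s]; only the phases vary, and near [s] they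
   are values of the metric. *)
apply: (@near_eq_continuous_at _ _ _
  (fun t => ((fun m => phase (v t (sg^-1%g m)) (u t m)), sg) : G)).
  apply: filterS2 fuv agrees => t [fut fvt] vu.
  by apply: (frame_div_eq fut); exact: frame_act_phase fut fvt vu.
apply: pair_continuous_at; last exact: cvg_cst.
apply: ptws_continuous_at => m; apply: set_type_continuous_at.
apply: (@near_eq_continuous_at _ _ _
  (fun t => hlb_metric (v t (sg^-1%g m), u t m))).
  apply: filterS2 fuv agrees => t [[_ _ u1] [_ _ v1]] vu.
  by rewrite phaseE // vu permKV.
apply: metric_continuous_at; [exact: cv|exact: cu|].
by apply: filterS agrees => t vu; rewrite vu permKV.
Qed.

End frames.

(** * Charts and local sections of principal bundles *)

Section charts.
Variables (G : topologicalGroupType) (X : topologicalType).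

Section gspace.
Variable (E : right_gspace G X) (c : gs_chart E).

Lemma gc_inv_proj p : gc_dom c p.1 -> gs_proj (gc_inv c p) = p.1.
Proof.
have [_ _ invU _ gK] := gc_homeo c => cp.
rewrite -(@gc_proj _ _ _ c) ?gK //; exact: invU.
Qed.

Lemma gc_invK p : gc_dom c p.1 -> gc_map c (gc_inv c p) = p.
Proof. by have [_ _ _ _ gK] := gc_homeo c => cp; apply: gK. Qed.

Lemma gc_mapK e : gc_dom c (gs_proj e) -> gc_inv c (gc_map c e) = e.
Proof. by have [_ _ _ fK _] := gc_homeo c => ce; apply: fK. Qed.

Lemma gc_map_act x g : gc_dom c x ->
  gc_map c (gs_act (gc_inv c (x, 1%g)) g) = (x, g).
Proof.
move=> cx; have px := gc_inv_proj (p := (x, 1%g)) cx.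
rewrite [LHS]surjective_pairing gc_proj ?gs_proj_act ?px //.
by rewrite gc_act ?px // gc_invK // mul1g.
Qed.

(** Charts assume equivariance of [gc_map] alone; comparing the images of both sides under it
    reduces the claim to [gc_map_act]. *)
Lemma gc_decomposition e : gc_dom c (gs_proj e) ->
  gs_act (gc_inv c (gs_proj e, 1%g)) (gc_map c e).2 = e.
Proof.
move=> ce; have px := gc_inv_proj (p := (gs_proj e, 1%g)) ce.
rewrite -[LHS]gc_mapK ?gs_proj_act ?px //.
by rewrite gc_map_act // -(gc_proj ce) -surjective_pairing gc_mapK.
Qed.

Lemma gc_section_continuous_at x : gc_dom c x ->
  {for x, continuous (fun y => gc_inv c (y, 1%g))}.
Proof.
move=> cx; have [[_ cinv] _ _ _ _] := gc_homeo c.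
have ci : {for x, continuous (fun y : X => y)} by [].
have c1 : {for x, continuous (fun _ : X => 1%g : G)} by exact: cvg_cst.
have cp := pair_continuous_at ci c1.
apply: (comp_continuous_at cp).
move/(open_within_continuousP _ (open_setXT (gc_open c))) : cinv.
by apply; split.
Qed.

Lemma gc_map_continuous_at e : gc_dom c (gs_proj e) ->
  {for e, continuous (gc_map c)}.
Proof.
move=> ce; have [[cmap _] _ _ _ _] := gc_homeo c.
have oc := open_preimage (@gs_proj_continuous _ _ E) (gc_open c).
by move/(open_within_continuousP _ oc) : cmap; apply.
Qed.

Lemma gs_act_continuous_at (S : topologicalType) (e : S -> E) (g : S -> G) s :
  {for s, continuous e} -> {for s, continuous g} ->
  {for s, continuous (fun t => gs_act (e t) (g t))}.
Proof.
move=> ce cg; have ceg := pair_continuous_at ce cg.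
exact: (comp_continuous_at ceg (@gs_act_continuous _ _ E _)).
Qed.

End gspace.

Variable P : principal_bundle G X.

Lemma pb_section x : exists (U : set X) (e : X -> P),
  [/\ open U, U x, forall y, U y -> {for y, continuous e} &
      forall y, U y -> gs_proj (e y) = y].
Proof.
have [c _ cx] := @pb_locally_trivial _ _ P x.
exists (gc_dom c), (fun y => gc_inv c (y, 1%g)); split=> //.
- exact: gc_open.
- exact: gc_section_continuous_at.
- by move=> y cy; rewrite gc_inv_proj.
Qed.

Lemma pb_fibre x : exists e : P, gs_proj e = x.
Proof. by have [U [e [_ Ux _ pe]]] := pb_section x; exists (e x); exact: pe. Qed.

End charts.

(** * Framings *)

Section framing.
Variables (R : realType) (X : topologicalType) (n : nat).
Local Notation G := (torus_sym R n).
Implicit Type T : twisted_covering R X n.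

(* An equivariant map from E to the bundle of unitary frames of the twist of T:
   its existence on a principal bundle P says that T is the twisted covering
   associated with P. *)
Definition framing T (E : right_gspace G X) (q : E -> 'I_n -> tc_twist T) :=
  [/\ forall k, continuous (fun e => q e k),
      forall e, is_frame (gs_proj e) (q e),
      forall e g, q (gs_act e g) = frame_act (q e) g &
      injective q].

Definition associated T (P : principal_bundle G X) :=
  exists q : P -> 'I_n -> tc_twist T, framing q.

Section gspace.
Variables (T : twisted_covering R X n) (E : right_gspace G X).
Variable q : E -> 'I_n -> tc_twist T.
Hypothesis fq : framing q.

Lemma framing_continuous_at (S : topologicalType) (e : S -> E) s k :
  {for s, continuous e} -> {for s, continuous (fun t => q (e t) k)}.
Proof. by have [cq _ _ _] := fq => ce; exact: (comp_continuous_at ce (cq k _)). Qed.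

Lemma framing_base e k : tc_map (lb_proj (q e k)) = gs_proj e.
Proof. by have [_ /(_ e)[]] := fq. Qed.

Lemma framing_unit e k : hlb_metric (q e k, q e k) = 1.
Proof. by have [_ /(_ e)[]] := fq. Qed.

(** Frames over one point lie in one orbit, and injectivity of [q] lifts this from frames to points
    of [E]. *)
Lemma framing_act_div e e' : gs_proj e = gs_proj e' ->
  gs_act e (frame_div (q e) (q e')) = e'.
Proof.
have [_ frq actq injq] := fq => ee'; apply: injq; rewrite actq.
by apply: frame_divK (frq _) _; rewrite ee'.
Qed.

(* A local section trivializes: the coordinate of e relative to the section e0
   is the element of G that takes the frame at e0 to the frame at e. *)
Lemma chart_of_section (U : set X) (e0 : X -> E) : open U ->
  (forall x, U x -> {for x, continuous e0}) ->
  (forall x, U x -> gs_proj (e0 x) = x) ->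
  exists c : gs_chart E,
    gc_dom c = U /\ forall x, U x -> gc_inv c (x, 1%g) = e0 x.
Proof.
move=> oU ce0 pe0; have [_ frq actq injq] := fq.
pose f (e : E) : X * G := (gs_proj e, frame_div (q (e0 (gs_proj e))) (q e)).
pose f' (p : X * G) : E := gs_act (e0 p.1) p.2.
have fr0 (e : E) : U (gs_proj e) -> is_frame (gs_proj e) (q (e0 (gs_proj e))).
  by move=> Ue; rewrite -{1}(pe0 _ Ue).
have oEU := open_preimage (@gs_proj_continuous _ _ E) oU.
have h : mutual_homeo_on (@gs_proj _ _ E @^-1` U) (U `*` setT) f f'.
  split; first split.
  - apply/(open_within_continuousP _ oEU) => e Ue.
    apply: pair_continuous_at; first exact: gs_proj_continuous.
    have c0 : {for e, continuous (fun t => e0 (gs_proj t))}.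
      by apply: comp_continuous_at (ce0 _ Ue); exact: gs_proj_continuous.
    have ci : {for e, continuous (fun t : E => t)} by [].
    apply: (@frame_div_continuous_at _ _ _ T _ (@gs_proj _ _ E)).
    + by move=> k; exact: framing_continuous_at.
    + by move=> k; exact: framing_continuous_at.
    + have : \forall t \near e, U (gs_proj t) by exact: open_nbhs_nbhs.
      by apply: filterS => t Ut; split; [exact: fr0|exact: frq].
  - apply/(open_within_continuousP _ (open_setXT oU)) => -[x g] [/= Ux _].
    have c1 : {for (x, g), continuous (fun p : X * G => e0 p.1)}.
      by apply: comp_continuous_at; [exact: fst_continuous|exact: ce0].
    have c2 : {for (x, g), continuous (fun p : X * G => p.2)}.
      exact: snd_continuous.
    exact: gs_act_continuous_at c1 c2.
  - by move=> e Ue.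
  - by move=> [x g] [/= Ux _]; rewrite /f' gs_proj_act /= pe0.
  - by move=> e Ue; rewrite /f /f' /= framing_act_div // pe0.
  - move=> [x g] [/= Ux _]; rewrite /f /f' /= gs_proj_act pe0 //.
    by congr (_, _); apply: (frame_div_eq (frq (e0 x))); rewrite actq.
have fp e : U (gs_proj e) -> (f e).1 = gs_proj e by [].
have fact e g : U (gs_proj e) -> (f (gs_act e g)).2 = ((f e).2 * g)%g.
  move=> Ue; rewrite {1}/f gs_proj_act.
  apply: (frame_div_eq (fr0 _ Ue)).
  rewrite frame_actM actq.
  by rewrite (frame_divK (fr0 _ Ue)).
exists (GSChart oU h fp fact); split=> // x Ux /=.
by rewrite /f' /= gs_act1.
Qed.

End gspace.

(** [f e] is the point of [P'] that has the same frame as [e]. It exists because some point over the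
    same base can be moved by the quotient of the two frames, and relative to a local section of
    [P'] that quotient is continuous. *)
Lemma framing_map T (P P' : principal_bundle G X)
    (q : P -> 'I_n -> tc_twist T) (q' : P' -> 'I_n -> tc_twist T) :
  framing q -> framing q' -> exists f : P -> P',
    [/\ continuous f, forall e, q' (f e) = q e &
        forall e, gs_proj (f e) = gs_proj e].
Proof.
move=> fq fq'; have [_ frq _ _] := fq; have [_ frq' actq' injq'] := fq'.
have ex e : exists e', q' e' = q e /\ gs_proj e' = gs_proj e.
  have [e0 e0e] := pb_fibre P' (gs_proj e).
  exists (gs_act e0 (frame_div (q' e0) (q e))); rewrite gs_proj_act e0e actq'.
  by split=> //; apply: (frame_divK (frq' _)); rewrite e0e.
pose f e := sval (cid (ex e)).
have fE e : q' (f e) = q e /\ gs_proj (f e) = gs_proj e.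
  by rewrite /f; case: cid.
exists f; split; [|by move=> e; case: (fE e)..] => e.
have [U [e0 [oU Ue ce0 pe0]]] := pb_section P' (gs_proj e).
have Ue' : \forall t \near e, U (gs_proj t).
  by apply: gs_proj_continuous; exact: open_nbhs_nbhs.
have c0 : {for e, continuous (fun t => e0 (gs_proj t))}.
  by apply: comp_continuous_at (ce0 _ Ue); exact: gs_proj_continuous.
apply: (@near_eq_continuous_at _ _ _ (fun t => gs_act (e0 (gs_proj t))
    (frame_div (q' (e0 (gs_proj t))) (q t)))).
  apply: filterS Ue' => t Ut; apply: injq'; rewrite actq'.
  have [-> _] := fE t; rewrite (frame_divK (frq' _)) //.
  by rewrite pe0 //; exact: frq.
apply: (gs_act_continuous_at c0).
apply: (@frame_div_continuous_at _ _ _ T _ (@gs_proj _ _ P)).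
- by move=> k; have h := framing_continuous_at fq' (k := k) c0.
- by move=> k; have [cq _ _ _] := fq; exact: cq.
- apply: filterS Ue' => t Ut; split; last exact: frq.
  by rewrite -{1}(pe0 _ Ut).
Qed.

(** The maps that match equal frames are mutually inverse and equivariant, since a point is
    determined by its frame. *)
Lemma associated_principal_iso T P P' :
  associated T P -> associated T P' -> principal_iso P P'.
Proof.
move=> [q fq] [q' fq'].
have [f [cf qf pf]] := framing_map fq fq'.
have [f' [cf' qf' pf']] := framing_map fq' fq.
have [_ _ actq injq] := fq; have [_ _ actq' injq'] := fq'.
exists f, f'; split=> //.
  by split=> // e; [apply: injq|apply: injq']; rewrite ?qf' ?qf ?qf'.
by move=> e a; apply: injq'; rewrite actq' !qf actq.
Qed.

Lemma associated_principal_transport T P P' :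
  principal_iso P P' -> associated T P -> associated T P'.
Proof.
move=> [f [f' [[cf cf' fK f'K] pf actf]]] [q [cq frq actq injq]].
exists (fun e k => q (f' e) k); split=> [k|e|e g|e e'].
- by move=> e; exact: (comp_continuous_at (cf' e) (cq k (f' e))).
- by rewrite -{1}(f'K e) pf; exact: frq.
- by rewrite -{1}(f'K e) -actf fK; exact: actq.
- by move=> /injq /(can_inj f'K).
Qed.

End framing.

(** * Homogeneous maps of line bundles and trivial Hermitian line bundles *)

Section homogeneous_maps.
Variables (R : realType) (Z : topologicalType).

(* On a line, homogeneous maps are linear. *)
Lemma lb_linear (L M : line_bundle R Z) (f : L -> M) :
  (forall w, lb_proj (f w) = lb_proj w) ->
  (forall a w, f (lb_scale a w) = lb_scale a (f w)) ->
  forall z, exists l : {linear lb_fiber L z -> lb_fiber M z},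
    forall v, f (lb_in v) = lb_in (l v).
Proof.
move=> pf fZ z.
have ex (v : lb_fiber L z) : exists v' : lb_fiber M z, f (lb_in v) = lb_in v'.
  by apply: lb_inP; rewrite pf lb_proj_in.
pose l v := sval (cid (ex v)).
have lE v : f (lb_in v) = lb_in (l v) by rewrite /l; case: cid.
have lZ a v : l (a *: v) = a *: l v.
  by apply: (@lb_in_inj _ _ M); rewrite -lE -!lb_scale_in -lE fZ.
have lD u v : l (u + v) = l u + l v.
  have [->|u0] := eqVneq u 0.
    by rewrite add0r -[in RHS](scale0r 0) lZ scale0r add0r.
  have [a ->] := lb_colinear v u0.
  by rewrite -[X in l (X + _)]scale1r -scalerDl !lZ scalerDl scale1r.
have l_lin : linear l by move=> a u v; rewrite lD lZ.
pose lB := GRing.isLinear.Build _ _ _ _ l l_lin.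
pose l' : {linear lb_fiber L z -> lb_fiber M z} := HB.pack l lB.
by exists l'.
Qed.

Lemma lb_linear_scale (L M : line_bundle R Z) (f : L -> M) :
  (forall z, exists l : {linear lb_fiber L z -> lb_fiber M z},
    forall v, f (lb_in v) = lb_in (l v)) ->
  forall a w, f (lb_scale a w) = lb_scale a (f w).
Proof.
move=> flin a w; have [l lE] := flin (lb_proj w).
by rewrite -{2}(lb_vecK w) lE !lb_scale_in /lb_scale lE linearZ.
Qed.

Lemma metric_coords (L : hermitian_line_bundle R Z) (w w' r : L) :
  lb_proj w = lb_proj r -> lb_proj w' = lb_proj r -> hlb_metric (r, r) = 1 ->
  hlb_metric (w, w') = hlb_metric (w, r) * Num.conj (hlb_metric (w', r)).
Proof.
move=> wr w'r r1; rewrite {1}(metric_coord w'r r1) metric_scaler // mulrC.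
by [].
Qed.

Lemma trivial_scale a (p : trivial_hermitian_line_bundle R Z) :
  lb_scale a p = (p.1, a * p.2).
Proof.
case: p => z v.
exact: (@lb_scale_in _ _ (trivial_hermitian_line_bundle R Z) a z (v : R[i]^o)).
Qed.

(** A trivialization pulls the constant section 1 back to [r]; conversely the coordinate of [w] is
    its pairing with [r]. *)
Lemma trivial_hermitian_isoP (L : hermitian_line_bundle R Z) :
  hermitian_iso L (trivial_hermitian_line_bundle R Z) <->
  exists r : Z -> L, [/\ continuous r, forall z, lb_proj (r z) = z &
    forall z, hlb_metric (r z, r z) = 1].
Proof.
split=> [[f [g [[cf cg fK gK] pf _ fm]]]|[r [cr pr r1]]].
  have pg z : lb_proj (g (z, 1)) = z by rewrite -pf gK.
  exists (fun z => g (z, 1)); split=> // z.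
    have ci : {for z, continuous (fun y : Z => y)} by [].
    have c1 : {for z, continuous (fun _ : Z => 1 : R[i])} by exact: cvg_cst.
    exact: (comp_continuous_at (pair_continuous_at ci c1) (cg _)).
  rewrite -fm // gK /hlb_metric /= /trivial_metric /trivial_dot /=.
  by rewrite rmorph1 mulr1.
pose f (w : L) : trivial_hermitian_line_bundle R Z :=
  (lb_proj w, hlb_metric (w, r (lb_proj w))).
pose g (p : trivial_hermitian_line_bundle R Z) : L := lb_scale p.2 (r p.1).
have crp w : {for w, continuous (fun w : L => r (lb_proj w))}.
  by apply: comp_continuous_at (cr _); exact: lb_proj_continuous.
exists f, g; split.
- split=> [w|p|w|[z v]].
  + have ci : {for w, continuous (fun w : L => w)} by [].
    apply: pair_continuous_at; first exact: lb_proj_continuous.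
    by apply: (metric_continuous_at ci (crp w)); apply: nearW => t; rewrite pr.
  + have c1 : {for p, continuous (fun p : Z * R[i] => p.2)}.
      exact: snd_continuous.
    have c2 : {for p, continuous (fun p : Z * R[i] => r p.1)}.
      by apply: comp_continuous_at (cr _); exact: fst_continuous.
    exact: (lb_scale_continuous_at c1 c2).
  + by rewrite /f /g /= -metric_coord ?pr.
  + by rewrite /f /g /= lb_proj_scale pr metric_scalel // r1 mulr1.
- by [].
- apply: lb_linear => // a w; rewrite trivial_scale /f /= lb_proj_scale.
  by rewrite metric_scalel // pr.
- move=> w w' ww'; rewrite (@metric_coords _ w w' (r (lb_proj w))) ?pr //.
  by rewrite -[LHS]/(trivial_metric (f w, f w')) /f ww'.
Qed.

End homogeneous_maps.

(** * Isomorphisms of twisted coverings as isometries covering a homeomorphism *)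

Section twisted_isomorphisms.
Variables (R : realType) (X : topologicalType) (n : nat).
Variables T T' : twisted_covering R X n.
Local Notation L := (tc_twist T).
Local Notation L' := (tc_twist T').

Lemma pullback_scale (phi : tc_space T -> tc_space T')
    (phi_continuous : continuous phi) a (e : pullback phi_continuous L') :
  (\val (lb_scale a e)).2 = lb_scale a (\val e).2.
Proof.
rewrite -[in RHS](lb_vecK e).
exact: (esym (@lb_scale_in _ _ L' a (phi (lb_proj e)) (lb_vec e))).
Qed.

(** This form eliminates the pullback: as [phi] is a homeomorphism, a point of the pullback is
    determined by its vector in [L'], its base point being the image under [psi] of the base point
    of that vector. *)
Lemma twisted_isoP : twisted_iso T T' <->
  exists (phi : tc_space T -> tc_space T') (psi : tc_space T' -> tc_space T)
         (f : L -> L') (g : L' -> L),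
    [/\ mutual_homeo phi psi, forall z, tc_map (phi z) = tc_map z,
        mutual_homeo f g &
        [/\ forall w, lb_proj (f w) = phi (lb_proj w),
        forall a w, f (lb_scale a w) = lb_scale a (f w) &
        forall w w', lb_proj w = lb_proj w' ->
          hlb_metric (f w, f w') = hlb_metric (w, w')]].
Proof.
split.
  move=> [phi [psi [cphi [hphi sphi [f [g [[cf cg fK gK] pf flin fm]]]]]]].
  have [cpsi phiK psiK] : [/\ continuous psi, cancel phi psi & cancel psi phi].
    by case: hphi.
  have fZ := lb_linear_scale flin.
  have pg w : lb_proj (g w) = lb_proj w by rewrite -pf gK.
  have gZ a w : g (lb_scale a w) = lb_scale a (g w).
    by apply: (can_inj fK); rewrite gK fZ gK.
  have pg2 w : phi (lb_proj w) = lb_proj (\val (g w)).2.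
    by rewrite -pg -pullbackP.
  have ex w' : exists e : pullback cphi L', \val e = (psi (lb_proj w'), w').
    have p : pullback_set phi (psi (lb_proj w'), w') by exact: psiK.
    by exists (to_pullback p).
  pose h w' := sval (cid (ex w')).
  have hE w' : \val (h w') = (psi (lb_proj w'), w') by rewrite /h; case: cid.
  exists phi, psi, (fun w => (\val (g w)).2), (fun w' => f (h w')).
  split=> //; split=> //.
  - have cv := Defs.compose_continuous (@val_pullback_continuous _ _ _ phi L')
      (@snd_continuous _ _).
    exact: (Defs.compose_continuous cg cv).
  - apply: (fun ch => Defs.compose_continuous ch cf).
    apply: continuous_comp_initial => w'.
    apply: (@near_eq_continuous_at _ _ _ (fun w' => (psi (lb_proj w'), w'))).
      by apply: nearW => t; rewrite -hE.
    have ci : {for w', continuous (fun w' : L' => w')} by [].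
    apply: pair_continuous_at ci.
    exact: (comp_continuous_at (@lb_proj_continuous _ _ _ w') (cpsi _)).
  - move=> w; apply: (can_inj gK); rewrite fK; apply: val_inj; rewrite hE.
    rewrite -pg2 phiK -pg [RHS]surjective_pairing.
    by [].
  - by move=> w'; rewrite fK hE.
  - by move=> a w; rewrite gZ pullback_scale.
  - move=> w w' ww'; have := fm (g w) (g w'); rewrite !pg => /(_ ww').
    by rewrite !gK => ->.
move=> [phi [psi [f [g [hphi sphi [cf cg fK gK] [pf fZ fm]]]]]].
have [cphi cpsi phiK psiK] := hphi.
exists phi, psi, cphi; split=> //.
have pg w' : lb_proj (g w') = psi (lb_proj w').
  by apply: (can_inj phiK); rewrite -pf gK psiK.
have gZ a w' : g (lb_scale a w') = lb_scale a (g w').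
  by apply: (can_inj fK); rewrite gK fZ gK.
pose F (e : pullback cphi L') : L := g (\val e).2.
have pF e : lb_proj (F e) = lb_proj e by rewrite /F pg -pullbackP phiK.
pose H (w : L) : pullback cphi L' :=
  @to_pullback _ _ _ phi L' (lb_proj w, f w) (esym (pf w)).
exists F, H; split=> //.
- split=> //.
  + have cv := Defs.compose_continuous (@val_pullback_continuous _ _ _ phi L')
      (@snd_continuous _ _).
    exact: (Defs.compose_continuous cv cg).
  + apply: continuous_comp_initial => w.
    apply: pair_continuous_at; [exact: lb_proj_continuous|exact: cf].
  + move=> e; apply: val_inj; rewrite /H /= pF /F gK.
    by rewrite [RHS]surjective_pairing.
- apply: lb_linear => // a e.
  by rewrite /F pullback_scale gZ.
- move=> e e' ee'; rewrite /F -fm ?gK //.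
  by rewrite !pg -!pullbackP; congr psi; congr phi; exact: ee'.
Qed.

Variable P : principal_bundle (torus_sym R n) X.

Lemma associated_twisted_transport :
  twisted_iso T T' -> associated T P -> associated T' P.
Proof.
move=> /twisted_isoP[phi [psi [f [g [[cphi _ phiK _] sphi [cf cg fK gK]]]]]].
move=> [pf fZ fm] [q [cq frq actq injq]].
exists (fun e k => f (q e k)); split=> [k|e|e a|e e' qq].
- by move=> e; exact: (comp_continuous_at (cq k e) (cf _)).
- have [px pinj p1] := frq e; split=> [k|k k'|k].
  + by rewrite pf sphi.
  + by rewrite !pf => /(can_inj phiK)/pinj.
  + by rewrite fm.
- by apply/funext => k; rewrite actq /frame_act fZ.
- by apply: injq; apply/funext => k; apply: (can_inj fK); exact: (congr1 (@^~ k) qq).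
Qed.

End twisted_isomorphisms.

(** * Points of the covering represented by entries of frames *)

Section lifts.
Variables (R : realType) (X : topologicalType) (n : nat).
Variables (T : twisted_covering R X n) (P : principal_bundle (torus_sym R n) X).
Variables (q : P -> 'I_n -> tc_twist T) (fq : framing q).

Lemma framing_onto z : exists e k, lb_proj (q e k) = z.
Proof.
have [_ frq _ _] := fq; have [e ez] := pb_fibre P (tc_map z).
have [k kz] := frame_onto (frq e) (esym ez).
by exists e, k.
Qed.

(** The base point of entry [k] of the frame at [e (tc_map y)], and [y] itself, are two lifts of
    [tc_map y] that agree at [z]; so one index serves near [z]. *)
Lemma framing_local_point (U : set X) (e : X -> P) (z : tc_space T) :
  open U -> U (tc_map z) -> {for tc_map z, continuous e} ->
  (forall x, U x -> gs_proj (e x) = x) ->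
  exists k, {for z, continuous (fun y => e (tc_map y))} /\
    \forall y \near z, lb_proj (q (e (tc_map y)) k) = y.
Proof.
move=> oU Uz ce pe; have [cq frq _ _] := fq.
have [k kz] := frame_onto (frq (e (tc_map z))) (esym (pe _ Uz)).
have [cs _] := tc_covering T.
have ces : {for z, continuous (fun y => e (tc_map y))}.
  exact: (comp_continuous_at (cs z) ce).
exists k; split=> //.
have Us : \forall y \near z, U (tc_map y) by apply: cs; exact: open_nbhs_nbhs.
have ci : {for z, continuous (fun y : tc_space T => y)} by [].
apply: (lifts_agree (covering_locally_injective (tc_covering T))) ci kz _.
  apply: (@comp_continuous_at _ _ _ (fun y => q (e (tc_map y)) k)).
    exact: (comp_continuous_at ces (cq k _)).
  exact: lb_proj_continuous.
by apply: filterS Us => y Uy; rewrite (framing_base fq) pe.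
Qed.

(** This exhibits the covering space as the quotient of [P * 'I_n] by G, and so shows that maps
    defined through representatives are well defined. *)
Lemma framing_same_point e k e' k' :
  lb_proj (q e k) = lb_proj (q e' k') ->
  exists2 g, e' = gs_act e g & k = (g.2 : 'S_n) k'.
Proof.
move=> kk'; have [_ frq actq _] := fq.
have ee' : gs_proj e = gs_proj e'.
  by rewrite -(framing_base fq e k) kk' (framing_base fq).
exists (frame_div (q e) (q e')); first by rewrite (framing_act_div fq).
have [_ injqe _] := frq e; apply: injqe.
by rewrite kk' -{1}(framing_act_div fq ee') actq lb_proj_scale.
Qed.

(** Both maps carry entry [k] of the frame at [e] for [q] to the same entry for [q']. They are
    defined through chosen representatives and are continuous because a local section of [P]
    supplies representatives that vary continuously. *)
Lemma framing_line_map (T' : twisted_covering R X n)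
    (q' : P -> 'I_n -> tc_twist T') : framing q' ->
  exists (phi : tc_space T -> tc_space T') (f : tc_twist T -> tc_twist T'),
    [/\ continuous phi, continuous f,
        forall e k, phi (lb_proj (q e k)) = lb_proj (q' e k) &
        forall w e k, lb_proj w = lb_proj (q e k) ->
          f w = lb_scale (hlb_metric (w, q e k)) (q' e k)].
Proof.
move=> fq'; have [cq frq actq _] := fq; have [cq' _ actq' _] := fq'.
have ex z : exists ek : P * 'I_n, lb_proj (q ek.1 ek.2) = z.
  by have [e [k ekz]] := framing_onto z; exists (e, k).
pose pt z := sval (cid (ex z)).
have ptE z : lb_proj (q (pt z).1 (pt z).2) = z by rewrite /pt; case: cid.
pose phi z := lb_proj (q' (pt z).1 (pt z).2).
pose f (w : tc_twist T) := let ek := pt (lb_proj w) in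
  lb_scale (hlb_metric (w, q ek.1 ek.2)) (q' ek.1 ek.2).
have phiE e k : phi (lb_proj (q e k)) = lb_proj (q' e k).
  have [g eg kg] := framing_same_point (esym (ptE (lb_proj (q e k)))).
  by rewrite /phi eg actq' lb_proj_scale -kg.
have fE w e k : lb_proj w = lb_proj (q e k) ->
    f w = lb_scale (hlb_metric (w, q e k)) (q' e k).
  move=> wek; have h := esym (etrans (ptE (lb_proj w)) wek).
  have [g eg kg] := framing_same_point h.
  rewrite /f /= eg actq actq' /frame_act -kg metric_scaler //.
  (* A change of representative brings in the phase twice, conjugated by the metric and plain in the
     vector, with product 1. *)
  by rewrite lb_scaleA mulrAC -[_ * \val _]mulrC -normCK circleP expr1n mul1r.
exists phi, f; split=> //.
- move=> z; have [U [e [oU Uz ce pe]]] := pb_section P (tc_map z).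
  have [k [ces near_z]] := framing_local_point oU Uz (ce _ Uz) pe.
  apply: (@near_eq_continuous_at _ _ _ (fun y => lb_proj (q' (e (tc_map y)) k))).
    by apply: filterS near_z => y yE; rewrite -{1}yE phiE.
  have c' : {for z, continuous (fun y => q' (e (tc_map y)) k)}.
    exact: (comp_continuous_at ces (cq' k _)).
  exact: (comp_continuous_at c' (@lb_proj_continuous _ _ _ _)).
- move=> w; have [U [e [oU Uz ce pe]]] := pb_section P (tc_map (lb_proj w)).
  have [k [ces near_z]] := framing_local_point oU Uz (ce _ Uz) pe.
  have cp := @lb_proj_continuous _ _ (tc_twist T) w.
  have near_w : \forall v \near w, lb_proj (q (e (tc_map (lb_proj v))) k) = lb_proj v.
    exact: cp near_z.
  have cew := comp_continuous_at cp ces.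
  have c1 : {for w, continuous (fun v => q (e (tc_map (lb_proj v))) k)}.
    exact: (comp_continuous_at cew (cq k _)).
  have c2 : {for w, continuous (fun v => q' (e (tc_map (lb_proj v))) k)}.
    exact: (comp_continuous_at cew (cq' k _)).
  have ci : {for w, continuous (fun v : tc_twist T => v)} by [].
  apply: (@near_eq_continuous_at _ _ _ (fun v =>
    lb_scale (hlb_metric (v, q (e (tc_map (lb_proj v))) k))
      (q' (e (tc_map (lb_proj v))) k))).
    by apply: filterS near_w => v vE; apply: fE.
  apply: lb_scale_continuous_at c2; apply: (metric_continuous_at ci c1).
  by apply: filterS near_w => v ->.
Qed.

End lifts.

(** * Uniqueness of the associated covering, and reduction to the symmetric group *)

Section associated.
Variables (R : realType) (X : topologicalType) (n : nat).
Variables (P : principal_bundle (torus_sym R n) X).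

Lemma associated_twisted_iso (T T' : twisted_covering R X n) :
  associated T P -> associated T' P -> twisted_iso T T'.
Proof.
move=> [q fq] [q' fq']; apply/twisted_isoP.
have [phi [f [cphi cf phiE fE]]] := framing_line_map fq fq'.
have [psi [g [cpsi cg psiE gE]]] := framing_line_map fq' fq.
have pf w : lb_proj (f w) = phi (lb_proj w).
  have [e [k ek]] := framing_onto fq (lb_proj w).
  by rewrite (fE _ _ _ (esym ek)) -ek phiE lb_proj_scale.
have fgK (T1 T2 : twisted_covering R X n) (q1 : P -> 'I_n -> tc_twist T1)
    (q2 : P -> 'I_n -> tc_twist T2) (f1 : tc_twist T1 -> tc_twist T2)
    (f2 : tc_twist T2 -> tc_twist T1) : framing q1 -> framing q2 ->
    (forall w e k, lb_proj w = lb_proj (q1 e k) ->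
          f1 w = lb_scale (hlb_metric (w, q1 e k)) (q2 e k)) ->
    (forall w e k, lb_proj w = lb_proj (q2 e k) ->
          f2 w = lb_scale (hlb_metric (w, q2 e k)) (q1 e k)) -> cancel f1 f2.
  move=> fq1 fq2 f1E f2E w.
  have [e [k ek]] := framing_onto fq1 (lb_proj w).
  rewrite (f1E _ _ _ (esym ek)) (f2E _ e k) ?lb_proj_scale //.
  rewrite metric_scalel // (framing_unit fq2) mulr1.
  by rewrite -metric_coord // (framing_unit fq1).
exists phi, psi, f, g; split.
- split=> // [z|z].
    by have [e [k <-]] := framing_onto fq z; rewrite phiE psiE.
  by have [e [k <-]] := framing_onto fq' z; rewrite psiE phiE.
- move=> z; have [e [k <-]] := framing_onto fq z.
  by rewrite phiE (framing_base fq) (framing_base fq').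
- by split=> //; [exact: (fgK _ _ q q')|exact: (fgK _ _ q' q)].
split=> [//|a w|w w' ww'].
  have [e [k ek]] := framing_onto fq (lb_proj w).
  rewrite (fE _ _ _ (esym ek)) (fE _ e k) ?lb_proj_scale //.
  by rewrite metric_scalel // lb_scaleA.
have [e [k ek]] := framing_onto fq (lb_proj w).
have ek' : lb_proj (q e k) = lb_proj w' by rewrite ek.
rewrite (fE _ _ _ (esym ek)) (fE _ _ _ (esym ek')).
rewrite metric_scalel ?lb_proj_scale // metric_scaler // (framing_unit fq') mulr1.
by rewrite -metric_coords // (framing_unit fq).
Qed.

Lemma act_transition (c d : gs_chart P) x : gc_dom c x -> gc_dom d x ->
  gs_act (gc_inv c (x, 1%g)) (transition c d x) = gc_inv d (x, 1%g).
Proof.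
move=> cx dx; have px := @gc_inv_proj _ _ _ d (x, 1%g) dx.
have := @gc_decomposition _ _ _ c (gc_inv d (x, 1%g)).
by rewrite px => /(_ cx).
Qed.

(** Transitions in S_n only permute the entries of the frames at the unit sections of the charts. So
    these entries single out one unit vector over each point of the covering, and this is [r]. *)
Lemma reduces_unit_section (T : twisted_covering R X n)
    (q : P -> 'I_n -> tc_twist T) : framing q ->
  reduces_to (@sym_subgroup R n) P <->
  exists r : tc_space T -> tc_twist T,
    [/\ continuous r, forall z, lb_proj (r z) = z &
        forall z, hlb_metric (r z, r z) = 1].
Proof.
move=> fq; have [cq frq actq injq] := fq.
split=> [[A atlasA AH]|[r [cr pr r1]]].
  have ex z : exists ck : gs_chart P * 'I_n, [/\ A ck.1, gc_dom ck.1 (tc_map z) &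
      lb_proj (q (gc_inv ck.1 (tc_map z, 1%g)) ck.2) = z].
    have [c Ac cz] := atlasA (tc_map z).
    have pc := @gc_inv_proj _ _ _ c (tc_map z, 1%g) cz.
    have [k kz] := frame_onto (frq (gc_inv c (tc_map z, 1%g))) (esym pc).
    by exists (c, k).
  pose ck z := sval (cid (ex z)).
  pose r z := q (gc_inv (ck z).1 (tc_map z, 1%g)) (ck z).2.
  have ckE z : [/\ A (ck z).1, gc_dom (ck z).1 (tc_map z) & lb_proj (r z) = z].
    by rewrite /r /ck; case: cid.
  have rE c k z : A c -> gc_dom c (tc_map z) ->
      lb_proj (q (gc_inv c (tc_map z, 1%g)) k) = z ->
      r z = q (gc_inv c (tc_map z, 1%g)) k.
    move=> Ac cz kz; have [Ad dz rz] := ckE z.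
    have tr := act_transition cz dz.
    have [_ injc _] := frq (gc_inv c (tc_map z, 1%g)).
    have t1 := AH _ _ _ Ac Ad cz dz.
    have rE : r z = q (gc_inv c (tc_map z, 1%g))
        (((transition c (ck z).1 (tc_map z)).2 : 'S_n) (ck z).2).
      by rewrite /r -tr actq /frame_act t1 lb_scale1.
    by rewrite rE; congr q; apply: injc; rewrite kz -rE.
  exists r; split; [move=> z|by move=> z; case: (ckE z)|]; last first.
    by move=> z; exact: (framing_unit fq).
  have [c Ac cz] := atlasA (tc_map z).
  have [k [ces near_z]] := framing_local_point fq (gc_open c) cz
    (gc_section_continuous_at cz) (fun x cx => @gc_inv_proj _ _ _ c (x, 1%g) cx).
  have [cs _] := tc_covering T.
  have near_c : \forall y \near z, gc_dom c (tc_map y).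
    by apply: cs; exact: open_nbhs_nbhs (conj (gc_open c) cz).
  apply: (@near_eq_continuous_at _ _ _ (fun y => q (gc_inv c (tc_map y, 1%g)) k)).
    by apply: filterS2 near_z near_c => y yE cy; exact: rE.
  exact: (comp_continuous_at ces (cq k _)).
exists [set c | forall x k, gc_dom c x ->
    r (lb_proj (q (gc_inv c (x, 1%g)) k)) = q (gc_inv c (x, 1%g)) k].
  move=> x; have [U [e [oU Ux ce pe]]] := pb_section P x.
  pose v y k := r (lb_proj (q (e y) k)).
  have frv y : U y -> is_frame y (v y).
    move=> Uy; have := frq (e y); rewrite (pe _ Uy) => -[qx qinj _].
    split=> [k|k k'|k]; [by rewrite pr|by rewrite !pr => /qinj|exact: r1].
  have frqe y : U y -> is_frame y (q (e y)).
    by move=> Uy; have := frq (e y); rewrite (pe _ Uy).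
  (* Moves an arbitrary local section to the one whose frame consists of the values of [r]. *)
  pose e1 y := gs_act (e y) (frame_div (q (e y)) (v y)).
  have qe1 y : U y -> q (e1 y) = v y.
    by move=> Uy; rewrite actq (frame_divK (frqe _ Uy) (frv _ Uy)).
  have ce1 y : U y -> {for y, continuous e1}.
    move=> Uy; have cqe k : {for y, continuous (fun t => q (e t) k)}.
      exact: (comp_continuous_at (ce _ Uy) (cq k _)).
    apply: (gs_act_continuous_at (ce _ Uy)).
    apply: (@frame_div_continuous_at _ _ _ T _ id) => [//|k|].
      have cp := comp_continuous_at (cqe k) (@lb_proj_continuous _ _ _ _).
      exact: (comp_continuous_at cp (cr _)).
    have Uy' : \forall t \near y, U t by exact: open_nbhs_nbhs.
    by apply: filterS Uy' => t Ut; split; [exact: frqe|exact: frv].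
  have pe1 y : U y -> gs_proj (e1 y) = y by move=> Uy; rewrite gs_proj_act pe.
  have [c [cU cE]] := chart_of_section fq oU ce1 pe1.
  exists c; last by rewrite cU.
  move=> y k /=; rewrite cU => Uy; rewrite cE // qe1 //.
  by rewrite /v pr.
move=> c d x Ac Ad cx dx m; have tr := act_transition cx dx.
set t := transition c d x in tr *.
(* At this index the frame of [d] is [t.1 m] times entry [m] of the frame of [c]; both are the value
   of [r] at the same point, so the scalar is 1. *)
have := Ad _ ((t.2 : 'S_n)^-1%g m) dx; rewrite -tr actq /frame_act permKV.
rewrite lb_proj_scale Ac // => /(congr1 (fun w => hlb_metric (w,
  q (gc_inv c (x, 1%g)) m))).
by rewrite metric_scalel // (framing_unit fq) mulr1 => tm; apply: val_inj.
Qed.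

Lemma associated_trivial_reduces (T : twisted_covering R X n) :
  associated T P -> trivial_twist T <-> reduces_to (@sym_subgroup R n) P.
Proof.
move=> [q fq]; apply: iff_trans (trivial_hermitian_isoP _) _.
exact: iff_sym (reduces_unit_section fq).
Qed.

End associated.

(** * The bundle of frames *)

Section frame_bundle.
Variables (R : realType) (X : topologicalType) (n : nat).
Variables (T : twisted_covering R X n).
Hypothesis n_ge1 : (1 <= n)%N.
Local Notation L := (tc_twist T).
Local Notation G := (torus_sym R n).
(** The index of the entry from which the base point of a frame is read. *)
Let k0 : 'I_n := Ordinal n_ge1.

(** Compose the inverse of [tc_map] on the sheet through each point [z k] over [x] with a unit
    section near [z k]. Entries whose base points coincide lie on one sheet, which contains a single
    point over [x]. *)
Lemma local_frame x : exists (U : set X) (u : X -> 'I_n -> L),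
  [/\ open U, U x, forall k y, U y -> {for y, continuous (fun t => u t k)} &
      forall y, U y -> is_frame y (u y)].
Proof.
have [_ cov] := tc_covering T.
have [U [oU Ux [V [oV tV sU hV]]]] := cov x.
have [z zinj zx] := fibre_enum T x.
have zxk k : tc_map (z k) = x by apply/zx; exists k.
(* [p] packs, for use with [choice], a neighbourhood of [x], a unit vector field on it and the sheet
   through [z k]. *)
have per k : exists p : set X * (X -> L) * set (tc_space T),
    [/\ open p.1.1 /\ p.1.1 x, V p.2 /\ p.2 (z k),
        forall y, p.1.1 y -> {for y, continuous p.1.2},
        forall y, p.1.1 y -> tc_map (lb_proj (p.1.2 y)) = y /\
          hlb_metric (p.1.2 y, p.1.2 y) = 1 &
        forall y, p.1.1 y -> p.2 (lb_proj (p.1.2 y))].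
  have : (tc_map (t:=T) @^-1` U) (z k) by rewrite /= zxk.
  rewrite sU => -[W VW Wz].
  have [t [[_ ct] _ tUW tK sK]] := hV _ VW.
  move/(open_within_continuousP _ oU) : ct => ct.
  have tx : t x = z k by rewrite -(zxk k) tK.
  have [N [r [oN Nz cr rE]]] := lb_unit_section L (z k).
  exists ([set y | U y /\ N (t y)], r \o t, W) => /=; split.
  - split; last by rewrite tx.
    rewrite openE => y [Uy Nty]; apply: filterI; first exact: open_nbhs_nbhs.
    by apply: ct => //; exact: open_nbhs_nbhs.
  - by [].
  - by move=> y [Uy Nty]; exact: (comp_continuous_at (ct _ Uy) (cr _ Nty)).
  - by move=> y [Uy Nty]; have [-> ->] := rE _ Nty; rewrite sK.
  - by move=> y [Uy Nty]; have [-> _] := rE _ Nty; exact: tUW.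
have [p pE] := choice per.
have near_p : \forall y \near x, forall k, (p k).1.1 y.
  by apply: filter_forall => k; have [[oU' U'x] _ _ _ _] := pE k; exact: open_nbhs_nbhs.
have : nbhs x [set y | forall k, (p k).1.1 y] by exact: near_p.
rewrite nbhsE => -[B [oB Bx] Bp].
exists B, (fun y k => (p k).1.2 y); split=> // [k y By|y By].
  by have [_ _ cp _ _] := pE k; apply: cp; exact: Bp.
split=> [k|k j kj|k].
- by have [_ _ _ /(_ y (Bp _ By k))[]] := pE k.
- have [_ [Vk Wk] _ _ /(_ y (Bp _ By k)) Wyk] := pE k.
  have [_ [Vj Wj] _ _ /(_ y (Bp _ By j)) Wyj] := pE j.
  have kjW : (p k).2 = (p j).2.
    by apply: tV Vk Vj _; exists (lb_proj ((p k).1.2 y)); split=> //; rewrite kj.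
  have [t [_ _ _ tK _]] := hV _ Vk.
  by apply: zinj; rewrite -(tK _ Wk) zxk -(zxk j) tK // kjW.
- by have [_ _ _ /(_ y (Bp _ By k))[]] := pE k.
Qed.

Definition frame_set : set {ptws 'I_n -> L} :=
  [set u | is_frame (tc_map (lb_proj (u k0))) u].

Definition frame_space := set_type frame_set.

HB.instance Definition _ := Topological.on frame_space.

Lemma frame_spaceP (u : frame_space) : frame_set (\val u).
Proof. exact: (set_mem (valP u)). Qed.

Definition to_frame (x : X) (u : 'I_n -> L) (ux : is_frame x u) : frame_space :=
  exist (fun u => u \in frame_set) u
    (mem_set (let: And3 h _ _ := ux in ecast x (is_frame x u) (esym (h k0)) ux)).

Definition frame_proj (u : frame_space) : X := tc_map (lb_proj (\val u k0)).

Definition frame_space_act (u : frame_space) (g : G) : frame_space :=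
  to_frame (is_frame_act g (frame_spaceP u)).

Lemma frame_coord_continuous k : continuous (fun u : frame_space => \val u k).
Proof.
apply: (@Defs.compose_continuous _ _ _ (fun u : frame_space => \val u)
  (fun u : {ptws 'I_n -> L} => u k)); last exact: (@Defs.coord_continuous L _ k).
exact: initial_continuous.
Qed.

Lemma frame_proj_continuous : continuous frame_proj.
Proof.
have [cs _] := tc_covering T.
have cp := Defs.compose_continuous (@frame_coord_continuous k0)
  (@lb_proj_continuous _ _ L).
exact: Defs.compose_continuous cp cs.
Qed.

Lemma frame_space_act_continuous :
  continuous (fun eg : frame_space * G => frame_space_act eg.1 eg.2).
Proof.
move=> eg; apply: set_type_continuous_at; apply: ptws_continuous_at => k; move: eg.
pose f (s : 'S_n) (eg : frame_space * G) : L :=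
  lb_scale (\val (eg.2.1 (s k))) (\val eg.1 (s k)).
apply: (@discrete_locally_continuous _ _ _ (fun eg : frame_space * G => eg.2.2) f).
  exact: Defs.compose_continuous (@Defs.snd_continuous _ _) (@Defs.snd_continuous _ _).
move=> s eg.
have c1 : continuous (fun eg : frame_space * G => eg.2.1).
  exact: Defs.compose_continuous (@Defs.snd_continuous _ _) (@Defs.fst_continuous _ _).
have c2 := Defs.compose_continuous c1 (@Defs.coord_continuous _ _ (s k)).
have c3 := Defs.compose_continuous c2 (@val_circle_continuous R).
have c4 := Defs.compose_continuous (@Defs.fst_continuous frame_space G)
  (@frame_coord_continuous (s k)).
exact: (lb_scale_continuous_at (c3 eg) (c4 eg)).
Qed.

Lemma frame_space_act1 u : frame_space_act u 1%g = u.
Proof. by apply: val_inj; exact: frame_act1. Qed.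

Lemma frame_space_actM u g h :
  frame_space_act u (g * h)%g = frame_space_act (frame_space_act u g) h.
Proof. by apply: val_inj; exact: frame_actM. Qed.

Lemma frame_proj_act u g : frame_proj (frame_space_act u g) = frame_proj u.
Proof. by have [+ _ _] := is_frame_act g (frame_spaceP u); exact. Qed.

Definition frame_gspace : right_gspace G X :=
  RightGSpace frame_proj_continuous frame_space_act_continuous frame_space_act1
    frame_space_actM frame_proj_act.

Lemma frame_gspace_framing :
  @framing R X n T frame_gspace (fun u k => \val (u : frame_space) k).
Proof.
split=> [k|u|u g|u v uv].
- exact: frame_coord_continuous.
- exact: frame_spaceP.
- by [].
- exact: val_inj.
Qed.

Lemma frame_gspace_locally_trivial : gs_atlas [set: gs_chart frame_gspace].
Proof.
move=> x; have [U [u [oU Ux cu fu]]] := local_frame x.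
(* Outside [U] the frame over [x] serves as default value. *)
have ex y : exists e : frame_space, U y -> \val e = u y.
  have [Uy|Uy] := pselect (U y); first by exists (to_frame (fu _ Uy)).
  by exists (to_frame (fu _ Ux)).
have [e eE] := choice ex.
have ce y : U y -> {for y, continuous (e : X -> frame_gspace)}.
  move=> Uy; apply: set_type_continuous_at; apply: ptws_continuous_at => k.
  apply: near_eq_continuous_at (cu k _ Uy).
  have : \forall t \near y, U t by exact: open_nbhs_nbhs.
  by apply: filterS => t Ut; rewrite eE.
have pe y : U y -> gs_proj (e y : frame_gspace) = y.
  by move=> Uy; rewrite /= /frame_proj eE //; have [+ _ _] := fu _ Uy; apply.
have [c [cU _]] := chart_of_section frame_gspace_framing oU ce pe.
by exists c; rewrite ?cU.
Qed.

Definition frame_bundle : principal_bundle G X :=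
  PrincipalBundle frame_gspace_locally_trivial.

Lemma frame_bundle_associated : associated T frame_bundle.
Proof. by exists (fun u k => \val (u : frame_space) k); exact: frame_gspace_framing. Qed.

End frame_bundle.

(** * The final topology of an orbit map *)

(** A copy of [T] that records [p], on which the quotient topology can be declared as an
    instance. *)
Definition final_topology (S T : Type) (p : S -> T) : Type := T.

Section final_topology.
Variables (S : topologicalType) (T : choiceType) (p : S -> T).
Local Notation F := (final_topology p).

Definition final_open := [set U : set F | open (p @^-1` U)].

Lemma final_openT : final_open [set: F].
Proof. by rewrite /final_open /= preimage_setT; exact: openT. Qed.

Lemma final_openI : setI_closed final_open.
Proof. by move=> A B; exact: openI. Qed.

Lemma final_open_bigU (I : Type) (f : I -> set F) :
  (forall i, final_open (f i)) -> final_open (\bigcup_i f i).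
Proof. by move=> oF; apply: bigcup_open => i _; exact: oF. Qed.

HB.instance Definition _ := Choice.on F.
HB.instance Definition _ := isOpenTopological.Build F final_openT final_openI
  final_open_bigU.

Lemma final_continuous : continuous (p : S -> F).
Proof. by apply/continuousP. Qed.

Variables (I : Type) (tau : I -> S -> S).
Hypothesis tau_continuous : forall i, continuous (tau i).
Hypothesis tau_invariant : forall i a, p (tau i a) = p a.
Hypothesis tau_transitive : forall a b, p a = p b -> exists i, tau i a = b.

(* As the fibres of p are the orbits of a family of continuous maps, p is
   open: the preimage of the image of A is the union of the preimages of A
   under these maps. *)
Lemma final_image_nbhs a (A : set S) : nbhs a A -> nbhs (p a : F) (p @` A).
Proof.
rewrite nbhsE => -[B [oB Ba] BA].
apply: (@filterS _ (nbhs (p a : F)) _ (p @` B)); first exact: image_subset.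
apply: open_nbhs_nbhs; split; last by exists a.
rewrite /open /= /final_open /=.
rewrite (_ : _ @^-1` _ = \bigcup_i (tau i @^-1` B)).
  by apply: bigcup_open => i _; apply: Defs.open_preimage oB; exact: tau_continuous.
apply/seteqP; split=> [b [c Bc cb]|b [i _ Bib]].
  by have [i ibc] := tau_transitive (esym cb); exists i; rewrite //= ibc.
by exists (tau i b) => //; exact: tau_invariant.
Qed.

(** Because [p] is open, continuity at a single point descends to the quotient, and not only global
    continuity. *)
Lemma final_continuous_at (U : topologicalType) (f : F -> U) a :
  {for a, continuous (fun b => f (p b))} -> {for (p a : F), continuous f}.
Proof.
move=> cf V fV; have /final_image_nbhs := cf V fV.
by apply: filterS => _ [b Vb <-].
Qed.

End final_topology.

(** * Covering spaces of locally compact Hausdorff spaces *)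

Section covering_spaces.
Variables (Z X : topologicalType) (s : Z -> X).
Hypothesis s_covering : covering_map s.
Hypothesis X_hausdorff : hausdorff_space X.

(** Points that cannot be separated have the same image in [X]; their sheets meet, hence coincide,
    and [s] is injective on a sheet. *)
Lemma covering_hausdorff : hausdorff_space Z.
Proof.
have [cs cov] := s_covering; move=> z z' zz'.
have szz' : s z = s z'.
  apply: X_hausdorff => A B /cs sA /cs sB.
  by have [y [Ay By]] := zz' _ _ sA sB; exists (s y).
have [U [oU Uz [V [oV tV sU hV]]]] := cov (s z).
have : (s @^-1` U) z by []; rewrite sU => -[W VW Wz].
have : (s @^-1` U) z' by rewrite /= -szz'.
rewrite sU => -[W' VW' Wz'].
have [y [Wy W'y]] := zz' _ _ (open_nbhs_nbhs (conj (oV _ VW) Wz))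
  (open_nbhs_nbhs (conj (oV _ VW') Wz')).
have WW' : W = W' by apply: tV VW VW' _; exists y.
have [t [_ _ _ tK _]] := hV _ VW.
by rewrite -(tK _ Wz) szz' tK // WW'.
Qed.

(** By regularity a compact neighbourhood of [s z] shrinks into an evenly covered set; the inverse
    of [s] on the sheet of [z] carries it back to [Z]. *)
Lemma covering_locally_compact :
  locally_compact [set: X] -> locally_compact [set: Z].
Proof.
have [cs cov] := s_covering; move=> X_lc z _.
have [K] := X_lc (s z) I; rewrite withinET => Kz [cK _].
have [U [oU Uz [V [oV tV sU hV]]]] := cov (s z).
have : (s @^-1` U) z by []; rewrite sU => -[W VW Wz].
have [t [[_ ct] sWU tUW tK sK]] := hV _ VW.
have KUz : nbhs (s z) (K `&` U) by apply: filterI => //; exact: open_nbhs_nbhs.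
have [N Nz NKU] := compact_regular X_hausdorff cK Kz KUz.
have cN : compact (closure N).
  by apply: (subclosed_compact (@closed_closure _ N) cK) => y /NKU[].
have ctN : compact (t @` closure N).
  apply: continuous_compact cN; apply: (@continuous_subspaceW _ _ _ U _ _ ct).
  by move=> y /NKU[].
exists (t @` closure N); last first.
  by split=> //; exact: compact_closed covering_hausdorff ctN.
rewrite withinET.
have sNz : nbhs z (s @^-1` N) := cs z N Nz.
have Wnz : nbhs z W := open_nbhs_nbhs (conj (oV _ VW) Wz).
apply: filterS (filterI sNz Wnz).
by move=> y [Ny Wy]; exists (s y); [exact: subset_closure|exact: (tK _ Wy)].
Qed.

End covering_spaces.

(** * The associated covering *)

Section associated_covering.
Variables (R : realType) (X : topologicalType) (n : nat).
Local Notation G := (torus_sym R n).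
Variable P : principal_bundle G X.

(* A set-theoretic trivialization of P: the coordinate of a point in a chart
   chosen for its base point.  It turns the quotients of P * 'I_n and
   P * 'I_n * R[i] by G into the sets X * 'I_n and X * 'I_n * R[i], with
   twisted topologies. *)
Let chosen_chart x : exists c : gs_chart P, gc_dom c x.
Proof. by have [c _ cx] := @pb_locally_trivial _ _ P x; exists c. Qed.

Definition gauge (e : P) : G := (gc_map (sval (cid (chosen_chart (gs_proj e)))) e).2.

Lemma gauge_act e g : gauge (gs_act e g) = (gauge e * g)%g.
Proof.
rewrite /gauge gs_proj_act; case: cid => c cx /=.
by rewrite gc_act.
Qed.

Lemma gauge_inj e e' : gs_proj e = gs_proj e' -> gauge e = gauge e' -> e = e'.
Proof.
rewrite /gauge => ee'; rewrite ee'; case: cid => c cx /= g_ee'.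
rewrite -(gc_decomposition (c := c) (e := e)) ?ee' // g_ee'.
exact: gc_decomposition.
Qed.

Lemma gauge_surj x g : exists e, gs_proj e = x /\ gauge e = g.
Proof.
have [e ex] := pb_fibre P x; exists (gs_act e ((gauge e)^-1 * g)%g).
by rewrite gs_proj_act gauge_act mulKVg.
Qed.

Lemma gauge_transitive e e' : gs_proj e = gs_proj e' ->
  gs_act e ((gauge e)^-1 * gauge e')%g = e'.
Proof.
by move=> ee'; apply: gauge_inj; rewrite ?gs_proj_act // gauge_act mulKVg.
Qed.

Definition sheet_map (ek : P * discrete_topology 'I_n) : X * 'I_n :=
  (gs_proj ek.1, ((gauge ek.1).2 : 'S_n) ek.2).

(** The triple (e, k, v) stands for v times entry k of the frame at e. When the gauge of e is (λ,
    σ), that entry is λ_{σ(k)} times the reference vector of index σ(k), as in [frame_act]. *)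
Definition twist_map (ekv : P * discrete_topology 'I_n * R[i]) :
    X * 'I_n * R[i] :=
  (sheet_map ekv.1, \val ((gauge ekv.1.1).1 (sheet_map ekv.1).2) * ekv.2).

(** Entry k of the frame at e becomes entry σ^{-1}(k) of the frame at eg, multiplied by λ_k; here
    and in [twist_act] the other components change so that the point or vector represented stays the
    same. *)
Definition sheet_act (g : G) (ek : P * discrete_topology 'I_n) :
    P * discrete_topology 'I_n :=
  (gs_act ek.1 g, (g.2 : 'S_n)^-1%g ek.2).

Definition twist_act (g : G) (ekv : P * discrete_topology 'I_n * R[i]) :
    P * discrete_topology 'I_n * R[i] :=
  (sheet_act g ekv.1, (\val (g.1 ekv.1.2))^-1 * ekv.2).

Lemma sheet_act_continuous g : continuous (sheet_act g).
Proof.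
move=> ek; have c1 : {for ek, continuous (fun ek : P * discrete_topology 'I_n => ek.1)}.
  exact: Defs.fst_continuous.
have cg : {for ek, continuous (fun _ : P * discrete_topology 'I_n => g)}.
  exact: cvg_cst.
have ck : continuous (fun ek : P * discrete_topology 'I_n =>
    (g.2 : 'S_n)^-1%g ek.2 : discrete_topology 'I_n).
  apply: (@discrete_locally_continuous _ _ _
    (fun ek : P * discrete_topology 'I_n => ek.2)
    (fun k _ => (g.2 : 'S_n)^-1%g k : discrete_topology 'I_n)).
    exact: Defs.snd_continuous.
  by move=> k; exact: cst_continuous.
exact: (pair_continuous_at (gs_act_continuous_at c1 cg) (ck ek)).
Qed.

Lemma sheet_act_invariant g ek : sheet_map (sheet_act g ek) = sheet_map ek.
Proof. by rewrite /sheet_map /= gs_proj_act gauge_act /= permM permKV. Qed.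

Lemma sheet_act_transitive ek ek' : sheet_map ek = sheet_map ek' ->
  exists g, sheet_act g ek = ek'.
Proof.
case: ek ek' => [e k] [e' k'] [ee' kk'].
exists ((gauge e)^-1 * gauge e')%g; rewrite /sheet_act /= gauge_transitive //.
congr (_, _); apply: (can_inj (permK ((gauge e').2 : 'S_n))).
by rewrite -kk' invMg invgK permM permKV.
Qed.

Lemma twist_act_continuous g : continuous (twist_act g).
Proof.
move=> ekv.
have c1 : continuous (fun ekv : P * discrete_topology 'I_n * R[i] => ekv.1).
  exact: Defs.fst_continuous.
have c2 : continuous (fun ekv : P * discrete_topology 'I_n * R[i] => ekv.1.2).
  exact: Defs.compose_continuous c1 (@Defs.snd_continuous _ _).
have c3 : {for ekv, continuous
    (fun ekv : P * discrete_topology 'I_n * R[i] => ekv.2)}.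
  exact: Defs.snd_continuous.
have c4 : continuous (fun ekv : P * discrete_topology 'I_n * R[i] =>
    (\val (g.1 ekv.1.2))^-1 : R[i]).
  apply: (@discrete_locally_continuous _ _ _
    (fun ekv : P * discrete_topology 'I_n * R[i] => ekv.1.2)
    (fun k _ => (\val (g.1 k))^-1 : R[i])); first exact: c2.
  by move=> k; exact: cst_continuous.
have c5 := comp_continuous_at (c1 ekv) (@sheet_act_continuous g _).
exact: (pair_continuous_at c5 (mulC_continuous_at (c4 ekv) c3)).
Qed.

Lemma twist_act_invariant g ekv : twist_map (twist_act g ekv) = twist_map ekv.
Proof.
rewrite /twist_map /= sheet_act_invariant; congr (_, _).
rewrite gauge_act /sheet_map /=.
by rewrite permM permKV permK -mulrA mulVKf ?circle_neq0.
Qed.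

Lemma twist_act_transitive a b : twist_map a = twist_map b ->
  exists g, twist_act g a = b.
Proof.
case: a b => [ek v] [ek' v'] [/=].
move=> ee' kk' vv'; have [g ekg] : exists g, sheet_act g ek = ek'.
  by apply: sheet_act_transitive; congr (_, _).
exists g; rewrite /twist_act /= ekg; congr (_, _).
move: vv'; rewrite -ekg /= gauge_act /= permM permKV permK -mulrA.
move=> /(mulfI (circle_neq0 _)) ->.
by rewrite mulKf // circle_neq0.
Qed.

Definition sheets := final_topology sheet_map.
Definition twist_total := final_topology twist_map.

HB.instance Definition _ := Topological.on sheets.
HB.instance Definition _ := Topological.on twist_total.

Definition sheets_proj (z : sheets) : X := z.1.
Definition twist_proj (w : twist_total) : sheets := w.1.

Lemma sheet_map_surj (z : sheets) : exists e k, sheet_map (e, k) = z.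
Proof.
have [e [ez e1]] := gauge_surj z.1 1%g; exists e, z.2.
by rewrite /sheet_map /= e1 ez /= perm1 -surjective_pairing.
Qed.

Lemma twist_map_surj (w : twist_total) : exists e k v, twist_map (e, k, v) = w.
Proof.
have [e [ez e1]] := gauge_surj w.1.1 1%g; exists e, w.1.2, w.2.
by rewrite /twist_map /sheet_map /= e1 ez /= perm1 mul1r -!surjective_pairing.
Qed.

Lemma sheet_map_continuous : continuous (sheet_map : _ -> sheets).
Proof. exact: final_continuous. Qed.

Lemma twist_map_continuous : continuous (twist_map : _ -> twist_total).
Proof. exact: final_continuous. Qed.

Lemma sheets_continuous_at (U : topologicalType) (f : sheets -> U) ek :
  {for ek, continuous (fun a => f (sheet_map a))} ->
  {for (sheet_map ek : sheets), continuous f}.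
Proof.
exact: (final_continuous_at sheet_act_continuous sheet_act_invariant
  sheet_act_transitive).
Qed.

Lemma twist_continuous_at (U : topologicalType) (f : twist_total -> U) a :
  {for a, continuous (fun b => f (twist_map b))} ->
  {for (twist_map a : twist_total), continuous f}.
Proof.
exact: (final_continuous_at twist_act_continuous twist_act_invariant
  twist_act_transitive).
Qed.

Lemma sheets_proj_continuous : continuous sheets_proj.
Proof.
move=> z; have [e [k <-]] := sheet_map_surj z; apply: sheets_continuous_at.
exact: (comp_continuous_at (@Defs.fst_continuous _ _ _) (@gs_proj_continuous _ _ P _)).
Qed.

Lemma twist_proj_continuous : continuous twist_proj.
Proof.
move=> w; have [e [k [v <-]]] := twist_map_surj w; apply: twist_continuous_at.
exact: (comp_continuous_at (@Defs.fst_continuous _ _ _) (@sheet_map_continuous _)).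
Qed.

(** * The quotients in the coordinates of one chart *)

Section chart.
Variable c : gs_chart P.
Local Notation U := (gc_dom c).

(** The left factor by which the gauge differs from the chart coordinate; it carries all the
    discontinuity of the gauge. *)
Definition chart_gauge x : G := gauge (gc_inv c (x, 1%g)).

Lemma gauge_chart e : U (gs_proj e) ->
  gauge e = (chart_gauge (gs_proj e) * (gc_map c e).2)%g.
Proof. by move=> Ue; rewrite -gauge_act gc_decomposition. Qed.

Definition chart_sheet (j : 'I_n) (x : X) : sheets :=
  sheet_map (gc_inv c (x, 1%g), j).

(** The points whose index relative to the chart [c] is [j]: the permutation of [chart_gauge]
    translates that index into the second component. *)
Definition sheet (j : 'I_n) : set sheets :=
  [set z | U z.1 /\ z.2 = ((chart_gauge z.1).2 : 'S_n) j].

Lemma sheetE j z : sheet j z -> chart_sheet j z.1 = z.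
Proof.
move=> [Uz zj]; rewrite [RHS]surjective_pairing zj /chart_sheet /sheet_map /=.
by rewrite gc_inv_proj.
Qed.

Lemma chart_sheetP j x : U x -> sheet j (chart_sheet j x) /\ (chart_sheet j x).1 = x.
Proof.
move=> Ux; have px := @gc_inv_proj _ _ _ c (x, 1%g) Ux.
by rewrite /chart_sheet /sheet /sheet_map /= px.
Qed.

Lemma sheet_of z : U z.1 -> exists j, sheet j z.
Proof.
move=> Uz; exists (((chart_gauge z.1).2 : 'S_n)^-1%g z.2); split=> //.
by rewrite permKV.
Qed.

Lemma sheet_eq i j z : sheet i z -> sheet j z -> i = j.
Proof. by move=> [_ zi] [_ zj]; apply: (@perm_inj _ (chart_gauge z.1).2); rewrite -zi. Qed.

(** The permutation component of the chart coordinate is continuous with values in a discrete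
    space. *)
Lemma near_chart_perm (e : P) : U (gs_proj e) ->
  \forall t \near e, U (gs_proj t) /\ (gc_map c t).2.2 = (gc_map c e).2.2.
Proof.
move=> Ue; have cm := gc_map_continuous_at Ue.
have c2 := comp_continuous_at cm (@Defs.snd_continuous _ _ _).
have c22 : {for e, continuous (fun t => (gc_map c t).2.2)}.
  exact: (comp_continuous_at c2 (@Defs.snd_continuous _ _ _)).
apply: filterI.
  by apply: gs_proj_continuous; apply: open_nbhs_nbhs; split=> //; exact: gc_open.
by apply: (c22 [set (gc_map c e).2.2]); exact/principal_filterP.
Qed.

Lemma sheet_map_in_sheet e k j : U (gs_proj e) ->
  sheet j (sheet_map (e, k)) <-> ((gc_map c e).2.2 : 'S_n) k = j.
Proof.
move=> Ue; rewrite /sheet /sheet_map /= gauge_chart //= permM.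
by split=> [[_ /perm_inj]|-> ].
Qed.

Lemma sheet_open j : open (sheet j).
Proof.
have oUP := open_preimage (@gs_proj_continuous _ _ P) (gc_open c).
rewrite /open /= /final_open /= openE => -[e k] /= ekj.
have Ue : U (gs_proj e) by case: ekj.
move/(sheet_map_in_sheet k j Ue) : ekj => ekj.
have near_e : \forall t \near (e, k), (U (gs_proj t.1) /\
    (gc_map c t.1).2.2 = (gc_map c e).2.2) /\ t.2 = k.
  apply: filterI.
    exact: (@Defs.fst_continuous P (discrete_topology 'I_n) (e, k) _ (near_chart_perm Ue)).
  apply: (@Defs.snd_continuous P (discrete_topology 'I_n) (e, k) [set k]).
  exact/principal_filterP.
apply: filterS near_e => -[t l] /= [[Ut tE] ->].
by apply/sheet_map_in_sheet => //; rewrite tE.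
Qed.

Lemma chart_sheet_continuous_at j x : U x -> {for x, continuous (chart_sheet j)}.
Proof.
move=> Ux; have ce := gc_section_continuous_at Ux.
have cj : {for x, continuous (fun _ : X => j : discrete_topology 'I_n)}.
  exact: cvg_cst.
exact: (comp_continuous_at (pair_continuous_at ce cj) (@sheet_map_continuous _)).
Qed.

Lemma evenly_covered_chart : evenly_covered sheets_proj U.
Proof.
exists (range sheet); split.
- by move=> _ [j _ <-]; exact: sheet_open.
- move=> _ _ [i _ <-] [j _ <-] [z [zi zj]].
  by rewrite (sheet_eq zi zj).
- apply/seteqP; split=> [z /sheet_of[j zj]|z [_ [j _ <-] [Uz _]] //].
  by exists (sheet j) => //; exists j.
- move=> _ [j _ <-]; exists (chart_sheet j); split; first split.
  + exact: (continuous_subspaceT sheets_proj_continuous).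
  + apply/(open_within_continuousP _ (gc_open c)).
    exact: chart_sheet_continuous_at.
  + by move=> z [].
  + by move=> x /(chart_sheetP j)[].
  + exact: sheetE.
  + by move=> x /(chart_sheetP j)[].
Qed.

Definition chart_phase (z : sheets) : circle R := (chart_gauge z.1).1 z.2.

(** Division by the phase of [chart_gauge] cancels the discontinuity of the gauge; [twist_coord_map]
    expresses the result in chart coordinates alone. *)
Definition twist_coord (w : twist_total) : R[i] :=
  (\val (chart_phase w.1))^-1 * w.2.

Definition twist_section (p : sheets * R[i]) : twist_total :=
  (p.1, \val (chart_phase p.1) * p.2).

Lemma twist_coordK w : twist_section (w.1, twist_coord w) = w.
Proof.
rewrite /twist_section /twist_coord /= mulVKf ?circle_neq0 //.
by rewrite -surjective_pairing.
Qed.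

Lemma twist_sectionK p : twist_coord (twist_section p) = p.2.
Proof. by rewrite /twist_coord /= mulKf // circle_neq0. Qed.

Lemma twist_coord_map e k v : U (gs_proj e) ->
  twist_coord (twist_map (e, k, v)) =
  \val ((gc_map c e).2.1 (((gc_map c e).2.2 : 'S_n) k)) * v.
Proof.
move=> Ue; rewrite /twist_coord /chart_phase /= gauge_chart //= permM permK.
by rewrite -mulrA mulKf // circle_neq0.
Qed.

Lemma twist_coord_continuous_at w : U w.1.1 -> {for w, continuous twist_coord}.
Proof.
have [e [k [v <-]]] := twist_map_surj w => /= Ue; apply: twist_continuous_at.
pose s : 'S_n := (gc_map c e).2.2.
have near_e : \forall t \near ((e, k), v), (U (gs_proj t.1.1) /\
    (gc_map c t.1.1).2.2 = s) /\ t.1.2 = k.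
  have c1 : continuous (fun t : P * discrete_topology 'I_n * R[i] => t.1).
    exact: Defs.fst_continuous.
  have c11 := Defs.compose_continuous c1 (@Defs.fst_continuous _ _).
  have c12 := Defs.compose_continuous c1 (@Defs.snd_continuous _ _).
  apply: filterI; first exact: (c11 (e, k, v) _ (near_chart_perm Ue)).
  by apply: (c12 (e, k, v) [set k]); exact/principal_filterP.
apply: (@near_eq_continuous_at _ _ _ (fun t : P * discrete_topology 'I_n * R[i] =>
    \val ((gc_map c t.1.1).2.1 (s k)) * t.2 : R[i])).
  by apply: filterS near_e => -[[t l] u] /= [[Ut tE] ->]; rewrite twist_coord_map // tE.
have c2 : {for (e, k, v), continuous
    (fun t : P * discrete_topology 'I_n * R[i] => t.2)}.
  exact: Defs.snd_continuous.
have c11 : {for (e, k, v), continuous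
    (fun t : P * discrete_topology 'I_n * R[i] => t.1.1)}.
  exact: (Defs.compose_continuous (@Defs.fst_continuous _ _) (@Defs.fst_continuous _ _)).
have cm := comp_continuous_at c11 (gc_map_continuous_at Ue).
have cg := comp_continuous_at cm (@Defs.snd_continuous _ _ _).
have cl := comp_continuous_at cg (@Defs.fst_continuous _ _ _).
have cls := comp_continuous_at cl (@Defs.coord_continuous (circle R) _ (s k) _).
have cv := comp_continuous_at cls (@val_circle_continuous R _).
exact: (mulC_continuous_at cv c2).
Qed.

Lemma twist_section_continuous_at (p : sheets * R[i]) : U p.1.1 -> {for p, continuous twist_section}.
Proof.
move=> Uz; have [j zj] := sheet_of (z := p.1) Uz.
have cz : continuous (fun p : sheets * R[i] => p.1) by exact: Defs.fst_continuous.
have cv : continuous (fun p : sheets * R[i] => p.2) by exact: Defs.snd_continuous.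
(* While the base point stays on the sheet [j], the section is [twist_map] applied to the unit
   section of the chart with the constant index [j]. *)
apply: (@near_eq_continuous_at _ _ _ (fun p : sheets * R[i] =>
    twist_map (gc_inv c (p.1.1, 1%g), j, p.2) : twist_total)).
  have near_z : \forall t \near p, sheet j t.1.
    have sheet_p : nbhs p.1 (sheet j).
      exact: (open_nbhs_nbhs (conj (@sheet_open j) zj)).
    exact: (cz p (sheet j) sheet_p).
  apply: filterS near_z => -[y u] /= yj.
  rewrite /twist_section /twist_map -[sheet_map _]/(chart_sheet j y.1) sheetE //.
have cx := comp_continuous_at (cz p) (@sheets_proj_continuous _).
have ce := comp_continuous_at cx (gc_section_continuous_at Uz).
have cj : {for p, continuous
    (fun _ : sheets * R[i] => j : discrete_topology 'I_n)} by exact: cvg_cst.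
have cej := pair_continuous_at (pair_continuous_at ce cj) (cv p).
exact: (comp_continuous_at cej (@twist_map_continuous _)).
Qed.

End chart.

Lemma sheets_covering_map : covering_map sheets_proj.
Proof.
split=> [|x]; first exact: sheets_proj_continuous.
have [c _ cx] := @pb_locally_trivial _ _ P x.
by exists (gc_dom c); split=> //; [exact: gc_open|exact: evenly_covered_chart].
Qed.

Lemma twist_in_bij z :
  set_bij setT (twist_proj @^-1` [set z]) (fun v : R[i]^o => (z, v) : twist_total).
Proof.
by split=> // [x y _ _ [] // | [y v] /= ->]; exists v.
Qed.

Lemma twist_locally_trivial z0 : exists (U : set sheets)
    (f : twist_total -> sheets * R[i]) (g : sheets * R[i] -> twist_total),
  [/\ open U /\ U z0,
      mutual_homeo_on (twist_proj @^-1` U) (U `*` setT) f g,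
      forall e, U (twist_proj e) -> (f e).1 = twist_proj e &
      forall y, U y -> linear (fun v : R[i]^o => (f (y, v)).2 : R[i]^o)].
Proof.
have [c _ cz] := @pb_locally_trivial _ _ P (sheets_proj z0).
pose U : set sheets := sheets_proj @^-1` gc_dom c.
have oU : open U := open_preimage sheets_proj_continuous (gc_open c).
exists U, (fun w => (twist_proj w, twist_coord c w)), (twist_section c).
split; [by []| |by []|].
  split; first split.
  - apply/(open_within_continuousP _ (open_preimage twist_proj_continuous oU)).
    move=> w Uw; apply: pair_continuous_at; first exact: twist_proj_continuous.
    exact: twist_coord_continuous_at.
  - apply/(open_within_continuousP _ (open_setXT oU)) => p [Up _].
    exact: twist_section_continuous_at.
  - by move=> w Uw.
  - by move=> p [Up _].
  - by move=> w _; exact: twist_coordK.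
  - by move=> [z v] _ /=; rewrite twist_sectionK.
move=> y _ a u v; rewrite /twist_coord /=.
by rewrite mulrDr mulrCA.
Qed.

Definition twist_line_bundle : line_bundle R sheets :=
  @LineBundle R sheets twist_total twist_proj (fun=> R[i]^o)
    (fun z v => (z, v)) twist_proj_continuous twist_in_bij twist_locally_trivial.

Definition twist_metric (e : twist_line_bundle * twist_line_bundle) : R[i] :=
  @trivial_dot R (e.1 : twist_total).2 (e.2 : twist_total).2.

(** Coordinates in a chart differ from the second components by a common phase, which cancels in the
    metric; this is why the standard formula is continuous for the twisted topology. *)
Lemma twist_metric_coord c (w w' : twist_total) : w.1 = w'.1 ->
  twist_metric (w, w') = trivial_dot (twist_coord c w) (twist_coord c w').
Proof.
move=> ww'; rewrite /twist_metric /trivial_dot /twist_coord /= ww'.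
rewrite rmorphM /= mulrACA -normCK normfV circleP invr1 expr1n mul1r.
by [].
Qed.

Lemma twist_metric_continuous :
  {within [set e | lb_proj e.1 = lb_proj e.2], continuous twist_metric}.
Proof.
apply/subspace_continuousP => -[w w'] /= ww'.
have [c _ cw] := @pb_locally_trivial _ _ P w.1.1.
pose F (p : twist_line_bundle * twist_line_bundle) : R[i] :=
  twist_coord c p.1 * Num.conj (twist_coord c p.2).
have cF : {for (w, w'), continuous F}.
  have c1 : {for (w, w'), continuous
      (fun p : twist_line_bundle * twist_line_bundle => p.1)}.
    exact: Defs.fst_continuous.
  have c2 : {for (w, w'), continuous
      (fun p : twist_line_bundle * twist_line_bundle => p.2)}.
    exact: Defs.snd_continuous.
  have cw' : gc_dom c w'.1.1 by rewrite -[w'.1]ww'.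
  have c3 := comp_continuous_at c1 (twist_coord_continuous_at cw).
  have c4 := comp_continuous_at c2 (twist_coord_continuous_at cw').
  have c5 := comp_continuous_at c4 (@conjC_continuous R _).
  exact: (mulC_continuous_at c3 c5).
have FE (y y' : twist_total) : y.1 = y'.1 -> F (y, y') = twist_metric (y, y').
  by move=> yy'; exact: esym (twist_metric_coord c yy').
move=> A mA; have FA : nbhs (F (w, w')) A by rewrite FE.
apply: (@filterS _ (nbhs (w, w')) _ _ _ _ (cF _ FA)) => -[y y'] /= Fy yy'.
by move: Fy; rewrite /mkset FE.
Qed.

Lemma twist_metric_dot z :
  exists dot : {dot lb_fiber twist_line_bundle z for Num.conj},
    forall v w, twist_metric (lb_in v, lb_in w) = dot v w.
Proof. by exists (@trivial_dot R). Qed.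

Definition twist_bundle : hermitian_line_bundle R sheets :=
  HermitianLineBundle twist_metric_continuous twist_metric_dot.

Hypothesis n_ge1 : (1 <= n)%N.
Hypothesis X_locally_compact : locally_compact [set: X].
Hypothesis X_hausdorff : hausdorff_space X.

Lemma sheets_proj_surjective : set_surj setT setT sheets_proj.
Proof. by move=> x _; exists (x, Ordinal n_ge1). Qed.

Lemma sheets_proj_fibre x : (sheets_proj @^-1` [set x] #= `I_n)%card.
Proof.
apply: card_eq_trans (card_esym card_II).
rewrite (_ : _ @^-1` _ = (fun k : 'I_n => (x, k) : sheets) @` setT).
  by apply: inj_card_eq => k k' _ _ [].
apply/seteqP; split=> [[y k] /= <-|_ [k _ <-] //].
by exists k.
Qed.

Definition associated_covering : twisted_covering R X n :=
  @TwistedCovering R X n sheets sheets_proj twist_bundle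
    (covering_locally_compact sheets_covering_map X_hausdorff X_locally_compact)
    (covering_hausdorff sheets_covering_map X_hausdorff)
    sheets_covering_map sheets_proj_surjective sheets_proj_fibre.

Lemma twist_scale a (w : twist_bundle) :
  lb_scale a w = ((w : twist_total).1, a * (w : twist_total).2) :> twist_total.
Proof.
case: w => z v.
exact: (@lb_scale_in _ _ twist_bundle a z (v : R[i]^o)).
Qed.

Lemma associated_coveringP : associated associated_covering P.
Proof.
(* The frame at [e] consists of the classes of (e, k, 1). *)
exists (fun e k => twist_map (e, k, 1)); split.
- move=> k e.
  have ci : {for e, continuous (fun e : P => e)} by [].
  have ck : {for e, continuous (fun _ : P => k : discrete_topology 'I_n)}.
    exact: cvg_cst.
  have c1 : {for e, continuous (fun _ : P => 1 : R[i])} by exact: cvg_cst.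
  have cp := pair_continuous_at (pair_continuous_at ci ck) c1.
  exact: (comp_continuous_at cp (@twist_map_continuous _)).
- move=> e; split=> [//|k k' /= [] /perm_inj //|k].
  rewrite -[LHS]/(@trivial_dot R _ _) /trivial_dot /= mulr1 -normCK circleP.
  by rewrite expr1n.
- move=> e g; apply/funext => k; rewrite /frame_act.
  (* This representative is chosen so that [g] sends it to (eg, k, 1). *)
  have := twist_act_invariant g (e, (g.2 : 'S_n) k, \val (g.1 ((g.2 : 'S_n) k))).
  rewrite /twist_act /sheet_act /= permK mulVf ?circle_neq0 // => h.
  have hs := twist_scale (\val (g.1 ((g.2 : 'S_n) k)))
    (twist_map (e, (g.2 : 'S_n) k, 1) : twist_bundle).
  apply: (etrans h); apply: (etrans _ (esym hs)).
  by rewrite /twist_map /= mulr1 [in LHS]mulrC.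
- move=> e e' qq.
  have qk k : twist_map (e, k, 1) = twist_map (e', k, 1) := congr1 (@^~ k) qq.
  have g2 k : ((gauge e).2 : 'S_n) k = ((gauge e').2 : 'S_n) k.
    exact: (congr1 (fun w : X * 'I_n * R[i] => w.1.2) (qk k)).
  apply: gauge_inj; first exact:
    (congr1 (fun w : X * 'I_n * R[i] => w.1.1) (qk (Ordinal n_ge1))).
  apply: torus_sym_eq => [m|]; last exact/permP.
  have := congr1 snd (qk (((gauge e).2 : 'S_n)^-1%g m)).
  by rewrite /= -g2 permKV !mulr1 => /val_inj.
Qed.

End associated_covering.

(** * The correspondence *)

Section correspondence.
Variables (R : realType) (X : topologicalType) (n : nat).
Hypothesis X_locally_compact : locally_compact [set: X].
Hypothesis X_hausdorff : hausdorff_space X.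
Hypothesis n_ge1 : (1 <= n)%N.
Implicit Types (T : twisted_covering R X n).
Implicit Types (P : principal_bundle (torus_sym R n) X).

Lemma twisted_iso_associated T P T' P' : associated T P -> associated T' P' ->
  twisted_iso T T' <-> principal_iso P P'.
Proof.
move=> TP TP'; split=> [TT'|PP'].
  exact: (associated_principal_iso (associated_twisted_transport TT' TP)).
exact: (associated_twisted_iso (associated_principal_transport PP' TP)).
Qed.

Lemma ex_associated_bundle T : exists P, associated T P.
Proof. by exists (frame_bundle T n_ge1); exact: frame_bundle_associated. Qed.

Lemma ex_associated_covering P : exists T, associated T P.
Proof.
exists (associated_covering P n_ge1 X_locally_compact X_hausdorff).
exact: associated_coveringP.
Qed.

(** All three coverings are associated with one bundle, so no composite of pullback isomorphisms has
    to be formed. *)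
Lemma twisted_iso_trans T1 T2 T3 :
  twisted_iso T1 T2 -> twisted_iso T2 T3 -> twisted_iso T1 T3.
Proof.
move=> T12 T23; have [P T1P] := ex_associated_bundle T1.
have T2P := associated_twisted_transport T12 T1P.
exact: associated_twisted_iso T1P (associated_twisted_transport T23 T2P).
Qed.

Lemma principal_iso_trans P1 P2 P3 :
  principal_iso P1 P2 -> principal_iso P2 P3 -> principal_iso P1 P3.
Proof.
move=> P12 P23; have [T TP1] := ex_associated_covering P1.
have TP2 := associated_principal_transport P12 TP1.
exact: associated_principal_iso TP1 (associated_principal_transport P23 TP2).
Qed.

Lemma iso_class_eq (S : Type) (iso : S -> S -> Prop) (C D : iso_classes iso) :
  (forall t, class_pred C t <-> class_pred D t) -> C = D.
Proof.
case: C D => [c cP] [d dP] /= cd.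
have {}cd : c = d by apply/funext => t; apply/propext.
by case: d / cd dP => dP; congr IsoClass; exact: Prop_irrelevance.
Qed.

(** Defined by the relation and not by a representative, so that it depends on the class alone. *)
Let bundles_of (C : iso_classes (@twisted_iso R X n)) P :=
  exists2 T, class_pred C T & associated T P.

Let coverings_of (D : iso_classes (@principal_iso (torus_sym R n) X)) T :=
  exists2 P, class_pred D P & associated T P.

Let bundles_ofP C : exists P, bundles_of C = principal_iso P.
Proof.
have [T0 CE] := class_predP C; have [P0 TP0] := ex_associated_bundle T0.
exists P0; apply/funext => P; apply/propext; rewrite /bundles_of CE.
split=> [[T T0T TP]|PP0]; first by apply/(twisted_iso_associated TP0 TP).
have [T TP] := ex_associated_covering P.
by exists T => //; apply/(twisted_iso_associated TP0 TP).
Qed.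

Let coverings_ofP D : exists T, coverings_of D = twisted_iso T.
Proof.
have [P0 DE] := class_predP D; have [T0 TP0] := ex_associated_covering P0.
exists T0; apply/funext => T; apply/propext; rewrite /coverings_of DE.
split=> [[P P0P TP]|TT0]; first by apply/(twisted_iso_associated TP0 TP).
have [P TP] := ex_associated_bundle T.
by exists P => //; apply/(twisted_iso_associated TP0 TP).
Qed.

Definition class_bundle C := IsoClass (bundles_ofP C).
Definition class_covering D := IsoClass (coverings_ofP D).

Lemma class_bundleK : cancel class_bundle class_covering.
Proof.
move=> C; apply: iso_class_eq => T; split=> [[P [T1 CT1 T1P] TP]|CT].
  have T1T := associated_twisted_iso T1P TP.
  by have [T0 CE] := class_predP C; move: CT1; rewrite CE => /twisted_iso_trans; apply.
have [P TP] := ex_associated_bundle T.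
by exists P => //; exists T.
Qed.

Lemma class_coveringK : cancel class_covering class_bundle.
Proof.
move=> D; apply: iso_class_eq => P; split=> [[T [P1 DP1 TP1] TP]|DP].
  have P1P := associated_principal_iso TP1 TP.
  by have [P0 DE] := class_predP D; move: DP1; rewrite DE => /principal_iso_trans; apply.
have [T TP] := ex_associated_covering P.
by exists T => //; exists P.
Qed.

Lemma class_bundle_associated T P :
  class_bundle (class_of (@twisted_iso R X n) T) =
    class_of (@principal_iso (torus_sym R n) X) P ->
  associated T P.
Proof.
have [T0 T0P] := ex_associated_covering P.
(* Reflexivity places [P] in its own class; evaluating the equality of classes at [P] then yields a
   covering isomorphic to [T] and associated with [P]. *)
have PP := associated_principal_iso T0P T0P.
move=> /(congr1 (fun D => class_pred D P)) /= E.
have [T1 TT1 T1P] : bundles_of (class_of (@twisted_iso R X n) T) P.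
  by rewrite /class_bundle /= in E; rewrite E.
have [P0 TP0] := ex_associated_bundle T.
have T1P0 := associated_twisted_transport TT1 TP0.
exact: associated_principal_transport (associated_principal_iso T1P0 T1P) TP0.
Qed.

End correspondence.

Theorem theorem2p9 (R : realType) (X : topologicalType) (n : nat)
    (X_locally_compact : locally_compact [set: X])
    (X_hausdorff : hausdorff_space X) (n_ge1 : (1 <= n)%N) :
  exists F : iso_classes (@twisted_iso R X n) ->
             iso_classes (@principal_iso (torus_sym R n) X),
    bijective F /\
    forall (T : twisted_covering R X n)
           (P : principal_bundle (torus_sym R n) X),
      F (class_of (@twisted_iso R X n) T) =
        class_of (@principal_iso (torus_sym R n) X) P ->
      (trivial_twist T <-> reduces_to (@sym_subgroup R n) P).
Proof.
exists (class_bundle X_locally_compact X_hausdorff n_ge1); split=> [|T P].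
  exists (class_covering X_locally_compact X_hausdorff n_ge1).
    exact: class_bundleK.
  exact: class_coveringK.
by move=> /class_bundle_associated; exact: associated_trivial_reduces.
Qed.
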